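(* Let $n\ge 2$, $1\le s\le n$, and let $\underline{k}=(k_1,\dots,k_s)$ with integers $k_i\ge 2$. Let $(p_i)_s$ and $(g_i)_s$ be divergent diagrams of $\underline{k}$-folds on $(\mathbb{C}^n,0)$ associated with the product groups $P=\prod_{i=1}^s\langle\alpha_i\rangle$ and $G=\prod_{i=1}^s\langle\beta_i\rangle$, respectively, where $\alpha_i$ and $\beta_i$ are reflections of order $k_i$ on $(\mathbb{C}^n,0)$. Then $(p_i)_s$ and $(g_i)_s$ are equivalent if and only if $P$ and $G$ are conjugate.
   Context: All maps are germs at $0$ of holomorphic maps fixing $0$. A (complex) reflection is a germ of biholomorphism $\varphi:(\mathbb{C}^n,0)\to(\mathbb{C}^n,0)$ of finite order $r\ge 2$ whose fixed-point set is a submanifold (germ) of codimension $1$; it need not be linear. For $k\ge2$, a $k$-fold is a holomorphic germ $f:(\mathbb{C}^n,0)\to(\mathbb{C}^n,0)$ of the form $f=l\circ f_1\circ h^{-1}$, where $f_1(x_1,\dots,x_n)=(x_1^k,x_2,\dots,x_n)$ and $h,l$ are germs of biholomorphisms of $(\mathbb{C}^n,0)$. A divergent diagram of $\underline{k}$-folds is a map germ $(g_i)_s=(g_1,\dots,g_s):(\mathbb{C}^n,0)\to(\mathbb{C}^{ns},0)$ where each $g_i$ is a $k_i$-fold. It is associated with the product group $\prod_{i=1}^s\langle\beta_i\rangle$ (the direct product of the cyclic groups generated by the reflections $\beta_i$) if $g_i\circ\beta_i=g_i$ for all $i$. Two divergent diagrams of $\underline{k}$-folds $(p_i)_s$ and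 $(g_i)_s$ are equivalent if there are germs of biholomorphisms $l_1,\dots,l_s$ and $h$ of $(\mathbb{C}^n,0)$ with $g_i=l_i\circ p_i\circ h^{-1}$ for all $i$. The product groups $P=\prod_{i=1}^s\langle\alpha_i\rangle$ and $G=\prod_{i=1}^s\langle\beta_i\rangle$ are conjugate if there is a single germ of biholomorphism $h$ of $(\mathbb{C}^n,0)$ with $h\langle\alpha_i\rangle h^{-1}=\langle\beta_i\rangle$ for all $i=1,\dots,s$. *)

(* Defs.v *)
From HB Require Import structures.
From mathcomp Require Import all_boot all_order all_algebra.
From mathcomp Require Import all_classical all_reals all_analysis.

Set Implicit Arguments.
Unset Strict Implicit.
Unset Printing Implicit Defensive.

Import Order.TTheory GRing.Theory Num.Theory.
Import numFieldNormedType.Exports.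

Local Open Scope classical_set_scope.
Local Open Scope ring_scope.

(* The definitions are for an arbitrary numClosedFieldType K, whose topology and
   normed module structure come from [numFieldNormedType]; they are meant for
   K = R[i], with R a realType, which is the field of complex numbers.

   A map germ (K^n,0) -> (K^n,0) is handled through a representative, that is a
   total function on K^n whose values away from 0 are irrelevant. Germs are
   compared with [germ_eq], and on holomorphic germs every predicate below is
   invariant under [germ_eq]. *)
Notation cspace K n := ('rV[K]_n).
Notation cmap K n := (cspace K n -> cspace K n).

Section Germs.
Context {K : numClosedFieldType} {n : nat}.
Implicit Types (f g h phi psi : cmap K n) (S : set (cspace K n)).

Definition germ_eq f g : Prop := \forall x \near (0 : cspace K n), f x = g x.

(* [differentiable] is taken over the field K, so for K = R[i]
   it is complex differentiability. *)
Definition holo_germ f : Prop :=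
  f 0 = 0 /\ \forall x \near (0 : cspace K n), differentiable f x.

Definition inverse_germs h h' : Prop :=
  [/\ holo_germ h, holo_germ h', germ_eq (h \o h') id & germ_eq (h' \o h) id].

Definition biholo_germ h : Prop := exists h', inverse_germs h h'.

Definition has_order phi (r : nat) : Prop :=
  [/\ (0 < r)%N, germ_eq (iter r phi) id &
      forall m, (0 < m < r)%N -> ~ germ_eq (iter m phi) id].

(* In suitable holomorphic coordinates psi, the germ of S at 0 is the linear
   subspace on which the first d coordinates vanish. *)
Definition submanifold_germ (d : nat) S : Prop :=
  (d <= n)%N /\
  exists2 psi, biholo_germ psi &
    \forall x \near (0 : cspace K n),
      S x <-> (forall j : 'I_n, (j < d)%N -> psi x 0 j = 0).

Definition reflection (r : nat) phi : Prop :=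
  [/\ biholo_germ phi, (2 <= r)%N, has_order phi r &
      submanifold_germ 1 [set x | phi x = x]].

Definition std_fold (k : nat) : cmap K n :=
  fun x => \row_j (if val j == 0%N then x 0 j ^+ k else x 0 j).

Definition kfold (k : nat) f : Prop :=
  holo_germ f /\
  exists l h h', [/\ biholo_germ l, inverse_germs h h' &
                     germ_eq f (l \o std_fold k \o h')].

(* The germs a^m and a^-m, for m a natural number. *)
Definition cyclic_germs (a : cmap K n) : set (cmap K n) :=
  [set phi | exists m, germ_eq phi (iter m a) \/ inverse_germs phi (iter m a)].

Definition conj_germs h h' (A : set (cmap K n)) : set (cmap K n) :=
  [set psi | exists2 phi, A phi & germ_eq psi (h \o phi \o h')].

End Germs.

Section Diagrams.
Context {K : numClosedFieldType} {n s : nat}.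
Implicit Types (p g alpha beta : 'I_s -> cmap K n).
Implicit Types (P G : 'I_s -> set (cmap K n)).

(* A map germ (K^n,0) -> (K^(ns),0) is given by its s components. *)
Definition divergent_diagram (k : 'I_s -> nat) g : Prop :=
  forall i, kfold (k i) (g i).

(* A product group, an external direct product, is given by the family of
   its factors. *)
Definition product_group beta : 'I_s -> set (cmap K n) :=
  fun i => cyclic_germs (beta i).

Definition associated beta g : Prop :=
  forall i, germ_eq (g i \o beta i) (g i).

Definition equivalent_diagrams p g : Prop :=
  exists (l : 'I_s -> cmap K n) (h h' : cmap K n),
    [/\ forall i, biholo_germ (l i), inverse_germs h h' &
        forall i, germ_eq (g i) (l i \o p i \o h')].

Definition conjugate_product_groups P G : Prop :=
  exists h h' : cmap K n,
    inverse_germs h h' /\ forall i, conj_germs h h' (P i) = G i.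

End Diagrams.

(* Main.v *)
(** Write a k-fold as [f = l o std o h^-1], where [std] is the standard fold.
The germs [phi] with [f o phi = f] are exactly the [h o rot z o h^-1] with
[z ^ k = 1], where [rot z] multiplies the first coordinate by [z]: if
[std o psi = std], the first coordinate of [psi] is the first coordinate of the
point times a root of unity which is constant along real rays, so it is equal
to its own differential at [0] and is linear. Hence the group generated by a
reflection of order k preserving [f] consists of all the symmetries of [f]; an
equivalence of diagrams conjugates symmetry groups, which gives one direction.

Conversely, if two k-folds [f] and [g] have the same symmetries, then
[F = g o h] is invariant under [rot z] and therefore factors as [F = M o std].
That [M] is holomorphic comes from Cauchy's formula averaged over the k
preimages of a point: since the sum over j of [1 / (w - z^j a)] is
[k w^(k-1) / (w^k - a^k)], the divided differences of [M] in the first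
coordinate are contour integrals that depend continuously on parameters. So
[g = L o f] with [L] holomorphic, and exchanging [f] and [g] inverts [L]. *)

Require Import Defs.
From HB Require Import structures.
From mathcomp Require Import all_boot all_order all_algebra.
From mathcomp Require Import complex ring lra.
From mathcomp Require Import all_classical all_reals all_analysis.

Set Implicit Arguments.
Unset Strict Implicit.
Unset Printing Implicit Defensive.

Import Order.TTheory GRing.Theory Num.Theory.
Import numFieldNormedType.Exports.

Local Open Scope classical_set_scope.
Local Open Scope ring_scope.

(** * Complex line integrals *)

(** The section of the standard fold given by [k.-root] depends on a choice of branch, and for k >=
    2 no branch is differentiable where the first coordinate vanishes, so holomorphy of the factor
    cannot come from composition. The branch locus is nevertheless never treated apart: at a base
    point b a root x0 of b_0 is frozen, and the factor is written f(x0, y') + (y_0 - b_0) J(y),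
    where y' stands for the other coordinates and J is a quotient of contour integrals. Continuity
    of J at b already makes the second term differentiable at b in all variables jointly, so neither
    differentiation under the integral sign nor a Hartogs-type theorem occurs. Contours are
    rectangles with sides parallel to the axes: only integrals over real segments arise, and
    Goursat's bisection applies directly. The value 2 pi i never enters. Cauchy's formula is used
    for functions vanishing at the poles, where it is a removable singularity statement, and the
    integral of the kernel, by which one divides, only has to be nonzero. *)

Lemma near_dist_lt (K : numFieldType) (V : normedModType K) (z : V) (e : K) :
  0 < e -> \forall t \near z, `|z - t| < e.
Proof.
move=> e0; have H := @cvgr_dist_lt K V V (nbhs z) _ id z _ e e0.
by apply: H; exact: cvg_id.
Qed.

(* The topology of [R[i]] is inferred only through its [numClosedFieldType]
   structure. *)
Definition cplx (R : realType) : numClosedFieldType := R[i].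

Section ComplexIntegral.
Local Open Scope complex_scope.
Variable R : realType.
Local Notation C := (cplx R).
Implicit Types (a b x y t : R) (z w : C).
Local Notation mu := (@lebesgue_measure R).

Lemma complexDE z w : z + w = (complex.Re z + complex.Re w) +i* (complex.Im z + complex.Im w).
Proof. by case: z => ? ?; case: w. Qed.

Lemma ReD z w : complex.Re (z + w) = complex.Re z + complex.Re w.
Proof. by rewrite complexDE. Qed.

Lemma ImD z w : complex.Im (z + w) = complex.Im z + complex.Im w.
Proof. by rewrite complexDE. Qed.

Lemma ReN z : complex.Re (- z) = - complex.Re z.
Proof. by case: z. Qed.

Lemma ImN z : complex.Im (- z) = - complex.Im z.
Proof. by case: z. Qed.

Lemma ReM z w : complex.Re (z * w) = complex.Re z * complex.Re w - complex.Im z * complex.Im w.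
Proof. by case: z => ? ?; case: w. Qed.

Lemma ImM z w : complex.Im (z * w) = complex.Re z * complex.Im w + complex.Im z * complex.Re w.
Proof. by case: z => ? ?; case: w. Qed.

Lemma normc_ge_Im z : `|complex.Im z|%:C <= `|z|.
Proof.
have := normc_ge_Re (z * 'i); rewrite ReiNIm normrN normrM.
suff -> : `|'i : R[i]| = 1 by rewrite mulr1.
by rewrite normc_def /= expr0n expr1n add0r sqrtr1.
Qed.

Lemma normc_le_ReIm z : `|z| <= (`|complex.Re z| + `|complex.Im z|)%:C.
Proof.
rewrite {1}(complexE z) (le_trans (ler_normD _ _))// normrM.
have -> : `|'i : R[i]| = 1 by rewrite normc_def /= expr0n expr1n add0r sqrtr1.
have H (u : R) : `|u%:C| = `|u|%:C.
  by rewrite normc_def /= expr0n /= addr0 sqrtr_sqr.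
by rewrite mul1r !H -rmorphD.
Qed.

Lemma normcR x : `|x%:C| = `|x|%:C.
Proof. by rewrite normc_def /= expr0n /= addr0 sqrtr_sqr. Qed.

Lemma Re_continuous : continuous (@complex.Re R : C -> R).
Proof.
move=> z; apply/(@cvgrPdist_lt R R C (nbhs z)) => e e0.
have e0' : 0 < e%:C by rewrite ltcR.
apply: filterS (near_dist_lt z e0') => w.
by rewrite -ltcR -ReN -ReD; apply: le_lt_trans (normc_ge_Re _).
Qed.

Lemma Im_continuous : continuous (@complex.Im R : C -> R).
Proof.
move=> z; apply/(@cvgrPdist_lt R R C (nbhs z)) => e e0.
have e0' : 0 < e%:C by rewrite ltcR.
apply: filterS (near_dist_lt z e0') => w.
by rewrite -ltcR -ImN -ImD; apply: le_lt_trans (normc_ge_Im _).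
Qed.

Lemma real_complex_continuous : continuous ((fun x => x%:C) : R -> C).
Proof.
move=> x; apply/(@cvgrPdist_lt C C R (nbhs x)) => e e0.
have eR : (complex.Re e)%:C = e by rewrite RRe_real// gtr0_real.
have e0' : 0 < complex.Re e by rewrite -ltcR eR.
apply: filterS (near_dist_lt x e0') => y xy.
by rewrite -rmorphB normcR -eR ltcR.
Qed.

Definition cint a b (f : R -> C) : C :=
  (\int[mu]_(x in `[a, b]) complex.Re (f x)) +i*
  (\int[mu]_(x in `[a, b]) complex.Im (f x)).

Definition rcontinuous a b (f : R -> C) := {within `[a, b], continuous (f : R -> C)}.

Lemma rcontinuous_Re a b f : rcontinuous a b f ->
  mu.-integrable `[a, b] (EFin \o (fun x => complex.Re (f x))).
Proof.
move=> cf; apply: continuous_compact_integrable; first exact: segment_compact.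
by move=> x; apply: continuous_comp; [exact: cf | exact: Re_continuous].
Qed.

Lemma rcontinuous_Im a b f : rcontinuous a b f ->
  mu.-integrable `[a, b] (EFin \o (fun x => complex.Im (f x))).
Proof.
move=> cf; apply: continuous_compact_integrable; first exact: segment_compact.
by move=> x; apply: continuous_comp; [exact: cf | exact: Im_continuous].
Qed.

Lemma eq_cint a b f g : {in `[a, b], f =1 g} -> cint a b f = cint a b g.
Proof.
by move=> fg; congr (_ +i* _); apply: eq_Rintegral => x xab; rewrite fg// -inE.
Qed.

Lemma cintD a b f g : rcontinuous a b f -> rcontinuous a b g ->
  cint a b (fun x => f x + g x) = cint a b f + cint a b g.
Proof.
move=> cf cg; rewrite /cint complexDE /=.
rewrite -!RintegralD//; try exact: rcontinuous_Re; try exact: rcontinuous_Im.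
by congr (_ +i* _); apply: eq_Rintegral => x _; rewrite ?ReD ?ImD.
Qed.

Lemma cintZ a b c f : rcontinuous a b f ->
  cint a b (fun x => c * f x) = c * cint a b f.
Proof.
move=> cf; rewrite /cint; case: c => u v.
have iR := rcontinuous_Re cf; have iI := rcontinuous_Im cf.
have mab : measurable `[a, b] by [].
have iZ (c : R) h : mu.-integrable `[a, b] (EFin \o h) ->
   mu.-integrable `[a, b] (EFin \o (fun x => c * h x)).
  by move=> ih; exact: (@integrableZl _ _ R mu `[a, b] mab c (EFin \o h) ih).
apply/eqP; rewrite eq_complex /=; apply/andP; split; apply/eqP.
  rewrite -!RintegralZl// -RintegralB//; try exact: iZ.
  by apply: eq_Rintegral => x _; rewrite ReM.
rewrite -!RintegralZl// -RintegralD//; try exact: iZ.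
by apply: eq_Rintegral => x _; rewrite ImM.
Qed.

Lemma rcontinuous_sub a b a' b' f : a <= a' -> b' <= b ->
  rcontinuous a b f -> rcontinuous a' b' f.
Proof.
move=> aa bb; apply: continuous_subspaceW => x /=.
by rewrite !in_itv /= => /andP[? ?]; rewrite (le_trans aa)//= (le_trans _ bb).
Qed.

Lemma cint_split a b c f : a <= b -> b <= c -> rcontinuous a c f ->
  cint a c f = cint a b f + cint b c f.
Proof.
move=> ab bc cf.
have H h : mu.-integrable `[a, c] (EFin \o h) ->
   \int[mu]_(x in `[a, c]) h x = \int[mu]_(x in `[a, b]) h x + \int[mu]_(x in `[b, c]) h x.
  move=> ih.
  have ih1 : mu.-integrable `[a, b] (EFin \o h).
    apply: integrableS ih => // x /=; rewrite !in_itv /= => /andP[-> xb].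
    exact: le_trans xb bc.
  have ih2 : mu.-integrable `[b, c] (EFin \o h).
    apply: integrableS ih => // x /=; rewrite !in_itv /= => /andP[xb ->].
    by rewrite (le_trans ab xb).
  have := @Rintegral_itvB R h (BLeft a) (BRight c) b ih.
  rewrite !bnd_simp => /(_ ab bc); rewrite Rintegral_itv_obnd_cbnd => [<-|].
    by rewrite addrC subrK.
  by apply: integrableS ih2 => //; exact: subset_itv_oc_cc.
by rewrite /cint complexDE /= -!H//; [exact: rcontinuous_Im|exact: rcontinuous_Re].
Qed.

Lemma Rint_cst a b M : a <= b -> \int[mu]_(x in `[a, b]) M = M * (b - a).
Proof.
move=> ab; rewrite Rintegral_cst//= lebesgue_measure_itv /= lte_fin.
by case: ltgtP ab => // -> _; rewrite subrr.
Qed.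

Lemma Rint_le a b (f : R -> R) M : a <= b -> mu.-integrable `[a, b] (EFin \o f) ->
  (forall x, x \in `[a, b] -> `|f x| <= M) ->
  `|\int[mu]_(x in `[a, b]) f x| <= M * (b - a).
Proof.
move=> ab fi fM; apply: le_trans (le_normr_Rintegral _ fi) _ => //.
have -> : M * (b - a) = \int[mu]_(x in `[a, b]) M.
  by rewrite Rint_cst.
apply: le_Rintegral => //.
- by apply/integrable_norm.
- apply: continuous_compact_integrable; first exact: segment_compact.
  exact: cst_continuous.
Qed.

(** The factor 2 comes from bounding the real and imaginary integrals separately. In every use the
    bound is made arbitrarily small, so a sharp constant would gain nothing. *)
Lemma cint_le a b f M : a <= b -> rcontinuous a b f ->
  (forall x, x \in `[a, b] -> `|f x| <= M%:C) ->
  `|cint a b f| <= (M * (b - a) *+ 2)%:C.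
Proof.
move=> ab cf fM; apply: le_trans (normc_le_ReIm _) _; rewrite lecR /= mulr2n.
apply: lerD; apply: Rint_le => //.
- exact: rcontinuous_Re.
- by move=> x xab; rewrite -lecR; apply: le_trans (fM x xab); exact: normc_ge_Re.
- exact: rcontinuous_Im.
- by move=> x xab; rewrite -lecR; apply: le_trans (fM x xab); exact: normc_ge_Im.
Qed.

Lemma Rint_id a b : a <= b -> \int[mu]_(x in `[a, b]) x = (b ^+ 2 - a ^+ 2) / 2.
Proof.
rewrite le_eqVlt => /orP[/eqP ->|ab].
  by rewrite set_itv1 Rintegral_set1 subrr mul0r.
have H := @continuous_FTC2 R id (fun x => x ^+ 2 / 2) a b ab.
rewrite /Rintegral H /= ?mulrBl//.
- by apply: continuous_subspaceT => x; exact: cvg_id.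
- split.
  + by move=> x _; apply: ex_derive.
  + apply: cvg_at_right_filter; apply: cvgM; last exact: cvg_cst.
    exact: exprn_continuous.
  + apply: cvg_at_left_filter; apply: cvgM; last exact: cvg_cst.
    exact: exprn_continuous.
- move=> x _; rewrite derive1E.
  have H2 : is_derive x 1 (fun x : R => x ^+ 2 / 2) x.
    apply: is_derive_eq.
    by rewrite !scaler0 add0r /GRing.scale /= !mulr1; field.
  exact: derive_val.
Qed.

Lemma cint_id a b : a <= b ->
  cint a b (fun x => x%:C) = ((b ^+ 2 - a ^+ 2) / 2)%:C.
Proof. by move=> ab; rewrite /cint /= Rint_id// Rint_cst// mul0r. Qed.

Lemma cint_1 a b : a <= b -> cint a b (fun x => 1) = (b - a)%:C.
Proof. by move=> ab; rewrite /cint /= !Rint_cst// mul0r mul1r. Qed.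

Lemma cint_affine a b (c d : C) : a <= b ->
  cint a b (fun x => c * x%:C + d) = c * ((b ^+ 2 - a ^+ 2) / 2)%:C + d * (b - a)%:C.
Proof.
move=> ab.
have ci : rcontinuous a b (fun x => x%:C).
  by apply: continuous_subspaceT; exact: real_complex_continuous.
have c1 : rcontinuous a b (fun x => 1).
  by apply: continuous_subspaceT; exact: cst_continuous.
have cZ (u : C) f : rcontinuous a b f -> rcontinuous a b (fun x => u * f x).
  by move=> cf x; apply: cvgM; [exact: cvg_cst|exact: cf].
rewrite (@eq_cint _ _ _ (fun x => c * x%:C + d * 1)); last first.
  by move=> x _; rewrite mulr1.
have H := @cintD a b _ _ (cZ c _ ci) (cZ d _ c1).
by rewrite [LHS]H (cintZ _ ci) (cintZ _ c1) cint_id// cint_1.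
Qed.

End ComplexIntegral.

Lemma diff_approx (K : numFieldType) (V W : normedModType K) (f : V -> W) (x : V) :
  differentiable f x -> forall e : K, 0 < e ->
  \forall y \near x, `|f y - f x - 'd f x (y - x)| <= e * `|y - x|.
Proof.
move=> /diff_locally /eqaddoP H e e0; move: (H e e0) => {}H.
rewrite (near_shift 0); apply: filterS H => y /=.
by rewrite subr0 addrK !fctE /= opprD addrA.
Qed.

Lemma approx_diff (K : numFieldType) (V W : normedModType K) (f : V -> W)
    (df : {linear V -> W}) (x : V) : continuous df ->
  (forall e : K, 0 < e ->
     \forall y \near x, `|f y - f x - df (y - x)| <= e * `|y - x|) ->
  differentiable f x.
Proof.
move=> dfc H; apply/diffP => /=.
(* The differential is by definition a chosen map with this property, so it is enough to exhibit one
   such map. *)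
apply: (@getPex _ (fun (df : {linear V -> W}) => continuous df /\
  forall y, f y = f (lim (nbhs x)) + df (y - lim (nbhs x))
                  +o_(y \near x) (y - lim (nbhs x)))).
exists df; split=> //.
suff : f = (fun y => f (lim (nbhs x)) + df (y - lim (nbhs x)))
           +o_ x (fun y => y - lim (nbhs x)) by rewrite funeqE.
apply/eqaddoP => e e0; rewrite lim_id//; apply: filterS (H e e0) => y.
by rewrite !fctE opprD addrA.
Qed.

(** * Contour integrals along rectangles *)

Section Rectangle.
Local Open Scope complex_scope.
Variable R : realType.
Local Notation C := (cplx R).
Implicit Types (a b x y t : R) (z w c d : C) (f g : C -> C).

Lemma Complex_continuousl y : continuous ((fun x => x +i* y) : R -> C).
Proof.
have -> : (fun x => x +i* y) = (fun x : R => (x%:C : C) + (0 +i* y : C)).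
  by apply/funext => x; rewrite complexDE /= addr0 add0r.
by move=> x; apply: cvgD; [exact: real_complex_continuous|exact: cvg_cst].
Qed.

Lemma Complex_continuousr x : continuous ((fun y => x +i* y) : R -> C).
Proof.
have -> : (fun y => x +i* y) = (fun y : R => (y%:C : C) * ('i : C) + (x%:C : C)).
  by apply/funext => y; apply/eqP; rewrite eq_complex ReD ImD ReM ImM /=; apply/andP; split;
    apply/eqP; ring.
move=> y; apply: cvgD; last exact: cvg_cst.
by apply: cvgM; [exact: real_complex_continuous|exact: cvg_cst].
Qed.

Definition crect x1 x2 y1 y2 : set C :=
  [set z | x1 <= complex.Re z <= x2 /\ y1 <= complex.Im z <= y2].

(** Continuity in the whole plane at each point of [A], which is stronger than continuity of the
    restriction: it follows at once from differentiability and passes to horizontal and vertical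
    slices by composition. *)
Definition continuous_on (A : set C) f := forall z, A z -> {for z, continuous f}.

Lemma rcontinuous_h f x1 x2 y1 y2 y : continuous_on (crect x1 x2 y1 y2) f ->
  y1 <= y <= y2 -> rcontinuous x1 x2 (fun x => f (x +i* y)).
Proof.
move=> cf yy; apply: continuous_in_subspaceT => x; rewrite inE /= in_itv /= => xx.
by apply: (@continuous_comp R C C (fun x => x +i* y) f);
  [exact: Complex_continuousl | exact: cf].
Qed.

Lemma rcontinuous_v f x1 x2 y1 y2 x : continuous_on (crect x1 x2 y1 y2) f ->
  x1 <= x <= x2 -> rcontinuous y1 y2 (fun y => f (x +i* y)).
Proof.
move=> cf xx; apply: continuous_in_subspaceT => y; rewrite inE /= in_itv /= => yy.
by apply: (@continuous_comp R C C (fun y => x +i* y) f);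
  [exact: Complex_continuousr | exact: cf].
Qed.

Definition cbdry x1 x2 y1 y2 : set C :=
  [set z | crect x1 x2 y1 y2 z /\ [\/ complex.Re z = x1, complex.Re z = x2,
                                    complex.Im z = y1 | complex.Im z = y2]].

Lemma continuous_onW (A B : set C) f : A `<=` B -> continuous_on B f -> continuous_on A f.
Proof. by move=> AB cf z /AB; exact: cf. Qed.

Lemma cbdry_sub x1 x2 y1 y2 : cbdry x1 x2 y1 y2 `<=` crect x1 x2 y1 y2.
Proof. by move=> z []. Qed.

(** The sides are written as degenerate rectangles, so that the slice lemmas for [crect] apply to
    them. *)
Lemma cbdry_sides x1 x2 y1 y2 : x1 <= x2 -> y1 <= y2 ->
  [/\ crect x1 x2 y1 y1 `<=` cbdry x1 x2 y1 y2, crect x1 x2 y2 y2 `<=` cbdry x1 x2 y1 y2,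
      crect x1 x1 y1 y2 `<=` cbdry x1 x2 y1 y2 & crect x2 x2 y1 y2 `<=` cbdry x1 x2 y1 y2].
Proof.
move=> x12 y12; split=> z [zx zy]; split; try split=> //.
- by have /andP[h1 h2] := zy; rewrite h1 (le_trans h2).
- by apply: Or43; apply/eqP; rewrite eq_le andbC.
- by have /andP[h1 h2] := zy; rewrite h2 andbT (le_trans _ h1).
- by apply: Or44; apply/eqP; rewrite eq_le andbC.
- by have /andP[h1 h2] := zx; rewrite h1 (le_trans h2).
- by apply: Or41; apply/eqP; rewrite eq_le andbC.
- by have /andP[h1 h2] := zx; rewrite h2 andbT (le_trans _ h1).
- by apply: Or42; apply/eqP; rewrite eq_le andbC.
Qed.

Lemma rcontinuous_bdry x1 x2 y1 y2 f : x1 <= x2 -> y1 <= y2 ->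
  continuous_on (cbdry x1 x2 y1 y2) f ->
  [/\ rcontinuous x1 x2 (fun x => f (x +i* y1)), rcontinuous x1 x2 (fun x => f (x +i* y2)),
      rcontinuous y1 y2 (fun y => f (x1 +i* y)) & rcontinuous y1 y2 (fun y => f (x2 +i* y))].
Proof.
move=> x12 y12 cf; have [b1 b2 b3 b4] := cbdry_sides x12 y12.
split.
- by apply: (rcontinuous_h (continuous_onW b1 cf)); rewrite lexx.
- by apply: (rcontinuous_h (continuous_onW b2 cf)); rewrite lexx.
- by apply: (rcontinuous_v (continuous_onW b3 cf)); rewrite lexx.
- by apply: (rcontinuous_v (continuous_onW b4 cf)); rewrite lexx.
Qed.

(* The contour integral along the positively oriented boundary of the rectangle. *)
Definition rint f x1 x2 y1 y2 : C :=
  cint x1 x2 (fun x => f (x +i* y1)) - cint x1 x2 (fun x => f (x +i* y2)) +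
  ('i : C) * (cint y1 y2 (fun y => f (x2 +i* y)) - cint y1 y2 (fun y => f (x1 +i* y))).

Lemma rint_splitx f x1 x2 x3 y1 y2 : x1 <= x2 -> x2 <= x3 ->
  rcontinuous x1 x3 (fun x => f (x +i* y1)) ->
  rcontinuous x1 x3 (fun x => f (x +i* y2)) ->
  rint f x1 x3 y1 y2 = rint f x1 x2 y1 y2 + rint f x2 x3 y1 y2.
Proof.
by move=> x12 x23 c1 c2; rewrite /rint (cint_split x12 x23 c1) (cint_split x12 x23 c2); ring.
Qed.

Lemma rint_splity f x1 x2 y1 y2 y3 : y1 <= y2 -> y2 <= y3 ->
  rcontinuous y1 y3 (fun y => f (x1 +i* y)) ->
  rcontinuous y1 y3 (fun y => f (x2 +i* y)) ->
  rint f x1 x2 y1 y3 = rint f x1 x2 y1 y2 + rint f x1 x2 y2 y3.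
Proof.
by move=> y12 y23 c1 c2; rewrite /rint (cint_split y12 y23 c1) (cint_split y12 y23 c2); ring.
Qed.

Lemma rintD f g x1 x2 y1 y2 : x1 <= x2 -> y1 <= y2 ->
  continuous_on (cbdry x1 x2 y1 y2) f -> continuous_on (cbdry x1 x2 y1 y2) g ->
  rint (fun z => f z + g z) x1 x2 y1 y2 = rint f x1 x2 y1 y2 + rint g x1 x2 y1 y2.
Proof.
move=> x12 y12 /(rcontinuous_bdry x12 y12)[f1 f2 f3 f4].
move=> /(rcontinuous_bdry x12 y12)[g1 g2 g3 g4].
by rewrite /rint (cintD f1 g1) (cintD f2 g2) (cintD f3 g3) (cintD f4 g4); ring.
Qed.

Lemma rintZ c f x1 x2 y1 y2 : x1 <= x2 -> y1 <= y2 ->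
  continuous_on (cbdry x1 x2 y1 y2) f ->
  rint (fun z => c * f z) x1 x2 y1 y2 = c * rint f x1 x2 y1 y2.
Proof.
move=> x12 y12 /(rcontinuous_bdry x12 y12)[f1 f2 f3 f4].
by rewrite /rint (cintZ c f1) (cintZ c f2) (cintZ c f3) (cintZ c f4); ring.
Qed.

(** Cauchy's theorem for the tangent maps that are subtracted in Goursat's argument, by explicit
    computation on the four sides. *)
Lemma rint_affine c d x1 x2 y1 y2 : x1 <= x2 -> y1 <= y2 ->
  rint (fun z => c * z + d) x1 x2 y1 y2 = 0.
Proof.
move=> x12 y12; rewrite /rint.
have E x y : c * (x +i* y : C) + d = c * (x%:C : C) + (c * ('i * y%:C) + d).
  have -> : (x +i* y : C) = (x%:C : C) + ('i * y%:C : C) by rewrite [LHS]complexE.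
  by ring.
have E' x y : c * (x +i* y : C) + d = (c * 'i) * (y%:C : C) + (c * x%:C + d).
  by rewrite E; ring.
have hE y : (fun x => c * (x +i* y : C) + d) = (fun x => c * (x%:C : C) + (c * ('i * y%:C) + d)).
  by apply/funext => x; exact: E.
have vE x : (fun y => c * (x +i* y : C) + d) = (fun y => (c * 'i) * (y%:C : C) + (c * x%:C + d)).
  by apply/funext => y; exact: E'.
rewrite !hE !vE !cint_affine//.
set u := ((_ - _) / _)%:C; set v := (((_ - _) / _)%:C).
rewrite !rmorphB; set X1 := x1%:C; set X2 := x2%:C; set Y1 := y1%:C; set Y2 := y2%:C.
by ring.
Qed.

(** The 4 is the 2 of [cint_le] times the 2 by which the perimeter exceeds width plus height. *)
Lemma rint_le f M x1 x2 y1 y2 : x1 <= x2 -> y1 <= y2 ->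
  continuous_on (cbdry x1 x2 y1 y2) f ->
  (forall z, cbdry x1 x2 y1 y2 z -> `|f z| <= M%:C) ->
  `|rint f x1 x2 y1 y2| <= (M * ((x2 - x1) + (y2 - y1)) *+ 4)%:C.
Proof.
move=> x12 y12 cf fM; have [f1 f2 f3 f4] := rcontinuous_bdry x12 y12 cf.
have [b1 b2 b3 b4] := cbdry_sides x12 y12.
have H1 : `|cint x1 x2 (fun x => f (x +i* y1))| <= (M * (x2 - x1) *+ 2)%:C.
  by apply: cint_le => // x; rewrite in_itv /= => xx; apply/fM/b1; rewrite /crect /= lexx.
have H2 : `|cint x1 x2 (fun x => f (x +i* y2))| <= (M * (x2 - x1) *+ 2)%:C.
  by apply: cint_le => // x; rewrite in_itv /= => xx; apply/fM/b2; rewrite /crect /= lexx.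
have H3 : `|cint y1 y2 (fun y => f (x1 +i* y))| <= (M * (y2 - y1) *+ 2)%:C.
  by apply: cint_le => // x; rewrite in_itv /= => xx; apply/fM/b3; rewrite /crect /= lexx.
have H4 : `|cint y1 y2 (fun y => f (x2 +i* y))| <= (M * (y2 - y1) *+ 2)%:C.
  by apply: cint_le => // x; rewrite in_itv /= => xx; apply/fM/b4; rewrite /crect /= lexx.
have n1 : `|'i : C| = 1 by rewrite normc_def /= expr0n expr1n add0r sqrtr1.
have -> : (M * ((x2 - x1) + (y2 - y1)) *+ 4)%:C =
  ((M * (x2 - x1) *+ 2)%:C + (M * (x2 - x1) *+ 2)%:C) +
  ((M * (y2 - y1) *+ 2)%:C + (M * (y2 - y1) *+ 2)%:C) :> C.
  by rewrite -!rmorphD; congr (_%:C); ring.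
apply: le_trans (ler_normD _ _) _; rewrite normrM n1 mul1r.
by apply: lerD; apply: le_trans (ler_normB _ _) _; apply: lerD.
Qed.

End Rectangle.

(** * Goursat's theorem and removable singularities *)

Lemma affine_continuous (K : numFieldType) (a b : K) : continuous (fun z => a * z + b).
Proof.
move=> z; apply: (@cvgD K K^o _ (nbhs z) _ ( *%R a) (cst b) (a * z) b).
  exact: mulrl_continuous.
exact: cvg_cst.
Qed.

Section Goursat.
Local Open Scope complex_scope.
Variable R : realType.
Local Notation C := (cplx R).
Implicit Types (a b x y t dx dy : R) (z w c d : C) (f g : C -> C).
Local Notation N z := (complex.Re (`|z| : C)).

Lemma norm_Re z : `|z| = (N z)%:C.
Proof. by rewrite RRe_real// normr_real. Qed.

Lemma Re_norm_le z (e : R) : (N z <= e) = (`|z| <= e%:C).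
Proof. by rewrite norm_Re lecR. Qed.

Lemma Re_norm_ge0 z : 0 <= N z.
Proof. by rewrite -ler0c -norm_Re normr_ge0. Qed.

Lemma Re_normD z w : N (z + w) <= N z + N w.
Proof. by rewrite Re_norm_le rmorphD /= -!norm_Re; exact: ler_normD. Qed.

Lemma rint_quarter f x1 x2 x3 y1 y2 y3 : x1 <= x2 -> x2 <= x3 -> y1 <= y2 -> y2 <= y3 ->
  continuous_on (crect x1 x3 y1 y3) f ->
  rint f x1 x3 y1 y3 = (rint f x1 x2 y1 y2 + rint f x2 x3 y1 y2) +
                       (rint f x1 x2 y2 y3 + rint f x2 x3 y2 y3).
Proof.
move=> x12 x23 y12 y23 cf.
have y13 := le_trans y12 y23; have x13 := le_trans x12 x23.
have H y : y1 <= y <= y3 -> rcontinuous x1 x3 (fun x => f (x +i* y)).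
  by move=> yy; exact: rcontinuous_h cf yy.
have V x : x1 <= x <= x3 -> rcontinuous y1 y3 (fun y => f (x +i* y)).
  by move=> xx; exact: rcontinuous_v cf xx.
rewrite (rint_splity y12 y23); [|apply: V; rewrite lexx//=..]; last by rewrite andbT.
by congr (_ + _); apply: rint_splitx => //; apply: H; rewrite ?lexx ?andbT ?y12.
Qed.

Lemma quarter_lt (a1 a2 a3 a4 e : R) : 4 * a1 < e -> 4 * a2 < e -> 4 * a3 < e ->
  4 * a4 < e -> ~ (e <= a1 + a2 + (a3 + a4)).
Proof. by lra. Qed.

(** Pigeonhole on the four quarters: if each had an integral below a quarter of the whole,
    [rint_quarter] would contradict the triangle inequality. Corner and size are kept apart so that
    iteration simply halves the sizes. *)
Lemma goursat_step f x y dx dy : 0 <= dx -> 0 <= dy ->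
  continuous_on (crect x (x + dx) y (y + dy)) f ->
  exists x' y', [/\ x <= x' /\ x' + dx / 2 <= x + dx,
    y <= y' /\ y' + dy / 2 <= y + dy &
    N (rint f x (x + dx) y (y + dy)) <=
    4 * N (rint f x' (x' + dx / 2) y' (y' + dy / 2))].
Proof.
move=> dx0 dy0 cf; apply: contrapT => H.
have dx2 : 0 <= dx / 2 by rewrite divr_ge0. have dy2 : 0 <= dy / 2 by rewrite divr_ge0.
have {}H x' y' : x <= x' -> x' + dx / 2 <= x + dx -> y <= y' -> y' + dy / 2 <= y + dy ->
    4 * N (rint f x' (x' + dx / 2) y' (y' + dy / 2)) < N (rint f x (x + dx) y (y + dy)).
  by move=> h1 h2 h3 h4; rewrite ltNge; apply/negP => h5; apply: H; exists x', y'.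
have ex : x + dx = x + dx / 2 + dx / 2 by rewrite -addrA -splitr.
have ey : y + dy = y + dy / 2 + dy / 2 by rewrite -addrA -splitr.
have := @rint_quarter f x (x + dx / 2) (x + dx) y (y + dy / 2) (y + dy).
rewrite !lerD2l !lerDl => /(_ dx2 _ dy2 _ cf).
have dx3 : dx / 2 <= dx by lra. have dy3 : dy / 2 <= dy by lra.
move=> /(_ dx3 dy3) E.
have h1 := H x y; have h2 := H (x + dx / 2) y.
have h3 := H x (y + dy / 2); have h4 := H (x + dx / 2) (y + dy / 2).
rewrite -!ex -!ey in h1 h2 h3 h4.
have xa : x <= x + dx / 2 by rewrite lerDl.
have xb : x + dx / 2 <= x + dx by rewrite lerD2l.
have ya : y <= y + dy / 2 by rewrite lerDl.
have yb : y + dy / 2 <= y + dy by rewrite lerD2l.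
have {}h1 := h1 (lexx _) xb (lexx _) yb; have {}h2 := h2 xa (lexx _) (lexx _) yb.
have {}h3 := h3 (lexx _) xb ya (lexx _); have {}h4 := h4 xa (lexx _) ya (lexx _).
have : N (rint f x (x + dx) y (y + dy)) <= N (rint f x (x + dx / 2) y (y + dy / 2)) +
   N (rint f (x + dx / 2) (x + dx) y (y + dy / 2)) +
   (N (rint f x (x + dx / 2) (y + dy / 2) (y + dy)) +
   N (rint f (x + dx / 2) (x + dx) (y + dy / 2) (y + dy))).
  by rewrite [in leLHS]E; apply: le_trans (Re_normD _ _) _; apply: lerD; exact: Re_normD.
exact: quarter_lt h1 h2 h3 h4.
Qed.

Lemma nested_point (u v : nat -> R) : (forall n, u n <= u n.+1) ->
  (forall n, v n.+1 <= v n) -> (forall n, u n <= v n) ->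
  exists p, forall n, u n <= p <= v n.
Proof.
move=> u1 v1 uv.
have um : {homo u : n m / (n <= m)%N >-> n <= m}.
  by apply: homo_leq => //; [exact: le_trans].
have vm n m : (n <= m)%N -> v m <= v n.
  elim: m => [|m IH]; first by rewrite leqn0 => /eqP ->.
  by rewrite leq_eqVlt => /predU1P[-> //|]; rewrite ltnS => /IH; exact: le_trans.
have ub m : ubound (range u) (v m).
  move=> _ [n _ <-]; case: (leqP n m) => nm.
    exact: le_trans (um _ _ nm) (uv m).
  exact: le_trans (uv n) (vm _ _ (ltnW nm)).
exists (sup (range u)) => n; apply/andP; split.
  apply: ub_le_sup; last by exists n.
  by exists (v 0%N); exact: ub.
by apply: ge_sup; [exists (u 0%N); exists 0%N | exact: ub].
Qed.

Lemma goursat f x y dx dy : 0 <= dx -> 0 <= dy ->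
  (forall z, crect x (x + dx) y (y + dy) z -> differentiable f z) ->
  rint f x (x + dx) y (y + dy) = 0.
Proof.
move=> dx0 dy0 df.
have cf : continuous_on (crect x (x + dx) y (y + dy)) f.
  by move=> z /df; exact: differentiable_continuous.
pose X n := dx / 2 ^+ n; pose Y n := dy / 2 ^+ n.
have XS n : X n.+1 = X n / 2 by rewrite /X exprSr invfM mulrA.
have YS n : Y n.+1 = Y n / 2 by rewrite /Y exprSr invfM mulrA.
have X0 n : 0 <= X n by rewrite divr_ge0// exprn_ge0.
have Y0 n : 0 <= Y n by rewrite divr_ge0// exprn_ge0.
pose Q (s : nat * (R * R)) := crect s.2.1 (s.2.1 + X s.1) s.2.2 (s.2.2 + Y s.1).
pose I (s : nat * (R * R)) := rint f s.2.1 (s.2.1 + X s.1) s.2.2 (s.2.2 + Y s.1).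
(* The continuity premise sits inside the relation because [dependent_choice] wants a successor for
   every state, including rectangles on which [f] is not continuous. *)
pose St (s s' : nat * (R * R)) := s'.1 = s.1.+1 /\ (continuous_on (Q s) f ->
   [/\ s.2.1 <= s'.2.1 /\ s'.2.1 + X s'.1 <= s.2.1 + X s.1,
       s.2.2 <= s'.2.2 /\ s'.2.2 + Y s'.1 <= s.2.2 + Y s.1 &
       N (I s) <= 4 * N (I s')]).
have stepP s : {s' | St s s'}.
  apply: cid; case: (pselect (continuous_on (Q s) f)) => [cs|]; last first.
    by exists (s.1.+1, s.2); split.
  have [x' [y' [h1 h2 h3]]] := goursat_step (X0 s.1) (Y0 s.1) cs.
  by exists (s.1.+1, (x', y')); split => // _; rewrite /I /= XS YS.
have [s [s0 sS]] := dependent_choice stepP (0%N, (x, y)).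
have sn n : (s n).1 = n by elim: n => [|n IH]; [rewrite s0|rewrite (sS n).1 IH].
have X0E : X 0%N = dx by rewrite /X expr0 divr1.
have Y0E : Y 0%N = dy by rewrite /Y expr0 divr1.
have subQ a b a' b' a1 b1 a1' b1' : a <= a' -> b' <= b -> a1 <= a1' -> b1' <= b1 ->
    crect a' b' a1' b1' `<=` (crect a b a1 b1 : set C).
  move=> h1 h2 h3 h4 z [/andP[z1 z2] /andP[z3 z4]]; split.
    by rewrite (le_trans h1 z1) (le_trans z2 h2).
  by rewrite (le_trans h3 z3) (le_trans z4 h4).
have QS n : Q (s n) `<=` crect x (x + dx) y (y + dy).
  elim: n => [|n IH]; first by rewrite s0 /Q /= X0E Y0E.
  apply: (subset_trans _ IH); have [|[h1 h2] [h3 h4] _] := (sS n).2; last exact: subQ.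
  by move=> z /IH; exact: cf.
have cQ n : continuous_on (Q (s n)) f by move=> z /QS; exact: cf.
have EN n : N (rint f x (x + dx) y (y + dy)) <= 4 ^+ n * N (I (s n)).
  elim: n => [|n IH]; first by rewrite s0 expr0 mul1r /I /= X0E Y0E.
  apply: (le_trans IH); rewrite exprSr -mulrA ler_wpM2l ?exprn_ge0//.
  by have [_ _] := (sS n).2 (cQ n).
have [px pxP] : exists p, forall n, (s n).2.1 <= p <= (s n).2.1 + X n.
  apply: nested_point => n; last by rewrite lerDl.
    by have [[]] := (sS n).2 (cQ n).
  by have [[]] := (sS n).2 (cQ n); rewrite !sn.
have [py pyP] : exists p, forall n, (s n).2.2 <= p <= (s n).2.2 + Y n.
  apply: nested_point => n; last by rewrite lerDl.
    by have [_ []] := (sS n).2 (cQ n).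
  by have [_ []] := (sS n).2 (cQ n); rewrite !sn.
pose p : C := px +i* py.
have pQ n : Q (s n) p by split; rewrite sn /=.
have dp : differentiable f p by apply: df; exact: (QS 0%N).
pose D := dx + dy; have D0 : 0 <= D by rewrite addr_ge0.
have XY n : X n + Y n = D / 2 ^+ n by rewrite -mulrDl.
(* On a small enough n-th rectangle [f] differs from its tangent map at [p] by at most
   [e * (D / 2 ^+ n)], and width plus height is [D / 2 ^+ n]. The factor [4 ^+ n] of [EN] cancels
   both powers of 2. *)
have key (e : R) : 0 < e -> N (rint f x (x + dx) y (y + dy)) <= e * (4 * D ^+ 2).
  move=> e0; have eC : (0 : C) < e%:C by rewrite ltcR.
  have /nbhs_ballP[dl /= dl0 dlP] := diff_approx dp eC.
  have dlE : dl = (complex.Re dl)%:C by rewrite RRe_real// gtr0_real.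
  have dl0' : 0 < complex.Re dl by rewrite -ltcR -dlE.
  have [n nP] : exists n, D / 2 ^+ n < complex.Re dl.
    exists (Num.bound (D / complex.Re dl)).
    rewrite ltr_pdivrMr ?exprn_gt0// mulrC -ltr_pdivrMr//.
    apply: lt_trans (archi_boundP _) _; first by rewrite divr_ge0// ltW.
    by rewrite -natrX ltr_nat ltn_expl.
  pose k : C := 'd f p 1.
  pose g w := f w - (k * w + (f p - k * p)).
  have kE w : 'd f p (w - p) = k * (w - p).
    by rewrite -[w - p in LHS]mulr1 -[_ * 1]/(_ *: _) linearZ /= mulrC.
  have g_le w : Q (s n) w -> `|g w| <= (e * (D / 2 ^+ n))%:C.
    move=> [/= wx wy]; rewrite !sn in wx wy.
    have wp : `|w - p| <= (D / 2 ^+ n)%:C.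
      apply: le_trans (normc_le_ReIm _) _; rewrite lecR -XY ReD ReN ImD ImN /=.
      have := pxP n; have := pyP n.
      by move=> ? ?; apply: lerD; rewrite ler_norml; lra.
    have wb : ball p dl w.
      rewrite /ball /= distrC; apply: le_lt_trans wp _.
      by rewrite dlE ltcR.
    have := dlP w wb; rewrite kE => H.
    have -> : g w = f w - f p - k * (w - p) by rewrite /g; ring.
    apply: (le_trans H); rewrite rmorphM /=.
    by apply: ler_pM => //; rewrite ler0c ltW.
  have ac : continuous_on (Q (s n)) (fun w => k * w + (f p - k * p)).
    by move=> z _; exact: affine_continuous.
  have gc : continuous_on (Q (s n)) g.
    by move=> z zQ; exact: (@cvgB C C C (nbhs z) _ _ _ _ _ (cQ n z zQ) (ac z zQ)).
  have xX : (s n).2.1 <= (s n).2.1 + X (s n).1 by rewrite lerDl.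
  have yY : (s n).2.2 <= (s n).2.2 + Y (s n).1 by rewrite lerDl.
  have fE : f = (fun w => g w + (k * w + (f p - k * p))).
    by apply/funext => w; rewrite /g subrK.
  have IE : I (s n) = rint g (s n).2.1 ((s n).2.1 + X (s n).1) (s n).2.2 ((s n).2.2 + Y (s n).1).
    have cb := continuous_onW (@cbdry_sub R _ _ _ _).
    have := rintD xX yY (cb _ _ _ _ _ gc) (cb _ _ _ _ _ ac);
      rewrite (rint_affine _ _ xX yY) addr0 => <-.
    exact: (congr1 (fun h => rint h (s n).2.1 ((s n).2.1 + X (s n).1) (s n).2.2 ((s n).2.2 + Y
      (s n).1)) fE).
  apply: le_trans (EN n) _.
  have addK' a b : a + b - a = b by rewrite addrAC subrr add0r.
  have g_le' z zb := g_le z (cbdry_sub zb).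
  have := rint_le xX yY (continuous_onW (@cbdry_sub R _ _ _ _) gc) g_le';
    rewrite -IE -Re_norm_le !addK' sn XY.
  have h4 : 0 < 4 ^+ n :> R by rewrite exprn_gt0.
  move=> h; apply: le_trans (ler_wpM2l (ltW h4) h) _.
  have -> : 4 ^+ n = 2 ^+ n * 2 ^+ n :> R by rewrite -exprMn -natrM.
  have h2 : 2 ^+ n != 0 :> R by rewrite expf_neq0.
  rewrite le_eqVlt; apply/orP; left; apply/eqP.
  by move: (2 ^+ n) h2 => t t0; field.
apply/eqP; rewrite -normr_eq0 norm_Re.
suff -> : N (rint f x (x + dx) y (y + dy)) = 0 by [].
apply/eqP; rewrite eq_le; apply/andP; split; last exact: Re_norm_ge0.
apply/ler_addgt0Pr => e e0; rewrite add0r.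
(* The added 1 keeps the divisor positive when [D = 0]. *)
have D1 : 0 < 4 * D ^+ 2 + 1 by apply: ltr_wpDl => //; apply: mulr_ge0 => //; exact: sqr_ge0.
apply: le_trans (key _ (divr_gt0 e0 D1)) _.
by rewrite mulrAC ler_pdivrMr// ler_pM2l// lerDl.
Qed.

End Goursat.

Section Removable.
Local Open Scope complex_scope.
Variable R : realType.
Local Notation C := (cplx R).
Implicit Types (x y e : R) (z w a : C) (f g : C -> C).
Local Notation N z := (complex.Re (`|z| : C)).

Lemma goursat_rect f x1 x2 y1 y2 : x1 <= x2 -> y1 <= y2 ->
  (forall z, crect x1 x2 y1 y2 z -> differentiable f z) -> rint f x1 x2 y1 y2 = 0.
Proof.
move=> x12 y12 df; have := @goursat R f x1 y1 (x2 - x1) (y2 - y1).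
by rewrite !subrKC !subr_ge0; apply.
Qed.

(** Four cuts isolate a square of half-side [e] around [a]. Goursat's theorem removes the outer
    pieces, and boundedness of [f] leaves at most [16 * M * e], for every small [e]. *)
Lemma rint_removable f a x1 x2 y1 y2 M (d : C) :
  x1 < complex.Re a < x2 -> y1 < complex.Im a < y2 ->
  (forall z, crect x1 x2 y1 y2 z -> z != a -> differentiable f z) ->
  0 < d -> (forall z, `|z - a| < d -> z != a -> `|f z| <= M%:C) ->
  rint f x1 x2 y1 y2 = 0.
Proof.
case/andP=> xa1 xa2 /andP[ya1 ya2] df d0 fM.
set u := complex.Re a; set v := complex.Im a.
have df' (z : C) : crect x1 x2 y1 y2 z -> complex.Re z != u \/ complex.Im z != v ->
    differentiable f z.
  by move=> zQ h; apply: df => //; apply/eqP => za; case: h; rewrite za eqxx.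
have cf' (z : C) : crect x1 x2 y1 y2 z -> complex.Re z != u \/ complex.Im z != v ->
    {for z, continuous f}.
  by move=> h1 h2; apply: differentiable_continuous; exact: df'.
have dE : d = (complex.Re d)%:C by rewrite RRe_real// gtr0_real.
have d0' : 0 < complex.Re d by rewrite -ltcR -dE.
(* Half of [d] is required since points of the square are only known to satisfy |Re (z - a)| + |Im
   (z - a)| <= 2 e. *)
have small e : 0 < e -> e < complex.Re d / 2 -> x1 < u - e -> u + e < x2 -> y1 < v - e ->
  v + e < y2 ->
    N (rint f x1 x2 y1 y2) <= 16 * M * e.
  move=> e0 ed h1 h2 h3 h4.
  have R1 y : y1 <= y <= y2 -> y != v -> rcontinuous x1 x2 (fun x => f (x +i* y)).
    move=> yy yv; have cy : continuous_on (crect x1 x2 y y) f.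
      move=> z [zx zy]; have zyE : complex.Im z = y by apply/eqP; rewrite eq_le andbC.
      by apply: cf'; [split; rewrite ?zyE|right; rewrite zyE].
    by apply: rcontinuous_h cy _; rewrite lexx.
  have R2 x : x1 <= x <= x2 -> x != u -> rcontinuous y1 y2 (fun y => f (x +i* y)).
    move=> xx xu; have cx : continuous_on (crect x x y1 y2) f.
      move=> z [zx zy]; have zxE : complex.Re z = x by apply/eqP; rewrite eq_le andbC.
      by apply: cf'; [split; rewrite ?zxE|left; rewrite zxE].
    by apply: rcontinuous_v cx _; rewrite lexx.
  have Z b1 b2 c1 c2 : x1 <= b1 -> b1 <= b2 -> b2 <= x2 -> y1 <= c1 -> c1 <= c2 -> c2 <= y2 ->
     [\/ b2 < u, u < b1, c2 < v | v < c1] -> rint f b1 b2 c1 c2 = 0.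
    move=> k1 k2 k3 k4 k5 k6 k7; apply: goursat_rect => // z [/andP[z1 z2] /andP[z3 z4]].
    apply: df'.
      by split; rewrite ?(le_trans k1 z1) ?(le_trans k4 z3) ?(le_trans z2 k3) ?(le_trans z4 k6).
    case: k7 => k; [left|left|right|right].
    - by rewrite lt_eqF// (le_lt_trans z2).
    - by rewrite gt_eqF// (lt_le_trans k).
    - by rewrite lt_eqF// (le_lt_trans z4).
    - by rewrite gt_eqF// (lt_le_trans k).
  have y12 : y1 <= y2 by move: h3 h4 e0; clear; lra.
  have yy1 : y1 <= y1 <= y2 by rewrite lexx.
  have yy2 : y1 <= y2 <= y2 by rewrite lexx andbT.
  have yv1 : y1 != v by rewrite lt_eqF.
  have yv2 : y2 != v by rewrite gt_eqF.
  have x2a : u - e <= x2 by lra.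
  have x2b : u - e <= u + e by lra.
  have y2b : v - e <= v + e by lra.
  have y2a : v - e <= y2 by lra.
  have x1a : x1 <= u + e by lra.
  have y1a : y1 <= v + e by lra.
  have ue : u - e < u by lra.
  have ue' : u < u + e by lra.
  have ve : v - e < v by lra.
  have ve' : v < v + e by lra.
  have E1 := rint_splitx (ltW h1) x2a (R1 _ yy1 yv1) (R1 _ yy2 yv2).
  have xsub y : y1 <= y <= y2 -> y != v -> rcontinuous (u - e) x2 (fun x => f (x +i* y)).
    by move=> yy yv; apply: rcontinuous_sub (R1 _ yy yv) => //; exact: ltW.
  have E2 := rint_splitx x2b (ltW h2) (xsub _ yy1 yv1) (xsub _ yy2 yv2).
  rewrite (Z x1 (u - e) y1 y2) ?lexx ?(ltW h1)// ?add0r in E1; last exact: Or41.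
  rewrite (Z (u + e) x2 y1 y2) ?lexx ?(ltW h2)// ?addr0 in E2; last exact: Or42.
  have C1 : rcontinuous y1 y2 (fun y => f ((u - e) +i* y)).
    by apply: R2; rewrite ?lt_eqF// (ltW h1).
  have C2 : rcontinuous y1 y2 (fun y => f ((u + e) +i* y)).
    by apply: R2; rewrite ?gt_eqF// x1a (ltW h2).
  have E3 := rint_splity (ltW h3) y2a C1 C2.
  rewrite (Z (u - e) (u + e) y1 (v - e)) ?lexx ?(ltW h1) ?(ltW h2) ?(ltW h3)// ?add0r in E3;
    last exact: Or43.
  have E4 := rint_splity y2b (ltW h4) (rcontinuous_sub (ltW h3) (lexx _) C1) (rcontinuous_sub
    (ltW h3) (lexx _) C2).
  rewrite (Z (u - e) (u + e) (v + e) y2) ?lexx ?(ltW h1) ?(ltW h2) ?(ltW h4)// ?addr0 in E4;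
    last exact: Or44.
  rewrite E1 E2 E3 E4 Re_norm_le.
  have sub : crect (u - e) (u + e) (v - e) (v + e) `<=` (crect x1 x2 y1 y2 : set C).
    move=> z [/andP[z1 z2] /andP[z3 z4]].
    by split; rewrite ?(le_trans (ltW h1) z1) ?(le_trans z2 (ltW h2)) ?(le_trans (ltW h3) z3)
      ?(le_trans z4 (ltW h4)).
  have ne (z : C) : cbdry (u - e) (u + e) (v - e) (v + e) z ->
    complex.Re z != u \/ complex.Im z != v.
    by move=> [_ [|||] ->]; [left; rewrite lt_eqF|left; rewrite gt_eqF|right;
      rewrite lt_eqF|right; rewrite gt_eqF].
  have := @rint_le R f M _ _ _ _ x2b y2b.
  have -> : M * (u + e - (u - e) + (v + e - (v - e))) *+ 4 = 16 * M * e by ring.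
  apply.
    by move=> z zb; apply: cf'; [exact/sub/cbdry_sub/zb|exact: ne].
  move=> z zb; have [/andP[z1 z2] /andP[z3 z4]] := cbdry_sub zb.
  apply: fM; last first.
    by apply/eqP => za; have := ne _ zb; rewrite za => -[]; rewrite eqxx.
  apply: le_lt_trans (normc_le_ReIm _) _; rewrite dE ltcR ReD ReN ImD ImN.
  have k1 : `|complex.Re z - complex.Re a| <= e.
    by rewrite -/u ler_norml lerBrDr lerBlDl [- e + u]addrC z1.
  have k2 : `|complex.Im z - complex.Im a| <= e.
    by rewrite -/v ler_norml lerBrDr lerBlDl [- e + v]addrC z3.
  apply: le_lt_trans (lerD k1 k2) _; rewrite -mulr2n -mulr_natr.
  by rewrite -ltr_pdivlMr.
apply/eqP; rewrite -normr_eq0 norm_Re.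
suff -> : N (rint f x1 x2 y1 y2) = 0 by [].
apply/eqP; rewrite eq_le Re_norm_ge0 andbT leNgt; apply/negP => n0.
set n := N _ in small n0.
(* [small] is applied to [m / 2]. The last entry gives 16 |M| m < n, against the bound of [small];
   the others keep the square inside the rectangle and inside the disc where [f] is bounded. *)
pose m := Num.min (Num.min (Num.min (u - x1) (x2 - u)) (Num.min (v - y1) (y2 - v)))
   (Num.min (complex.Re d / 2) (n / (16 * `|M| + 1))).
have M1 : 0 < 16 * `|M| + 1 by apply: ltr_wpDl => //; apply: mulr_ge0.
have m0 : 0 < m.
  by rewrite !lt_min !subr_gt0 xa1 xa2 ya1 ya2 !divr_gt0.
have [[m1 m2] [m3 m4] [m5 m6]] : [/\ m <= u - x1 /\ m <= x2 - u, m <= v - y1 /\ m <= y2 - v &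
   m <= complex.Re d / 2 /\ m <= n / (16 * `|M| + 1)].
  by have := lexx m; rewrite {2}/m !le_min => /andP[/andP[/andP[-> ->] /andP[-> ->]] /andP[->
    ->]].
have := small (m / 2).
have mm : m / 2 < m by rewrite ltr_pdivrMr// ltr_pMr// ltr1n.
have Hn : n <= 16 * M * (m / 2).
  by apply: small; move: m0 mm m1 m2 m3 m4 m5; clear; lra.
have : m * (16 * `|M| + 1) <= n by rewrite -ler_pdivlMr.
have : 16 * M * (m / 2) <= 16 * `|M| * (m / 2).
  by apply: ler_wpM2r; [rewrite divr_ge0// ltW|rewrite ler_pM2l// ler_norm].
have : 0 <= 16 * `|M| * m by rewrite !mulr_ge0// ltW.
by move: Hn m0; clear; lra.
Qed.

(** Since [g] vanishes at [a], the quotient is bounded near [a] by |g'(a)| + 1, so its singularity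
    is removable. For a general function the value at [a] is subtracted beforehand. *)
Lemma cauchy_zero g a x1 x2 y1 y2 :
  x1 < complex.Re a < x2 -> y1 < complex.Im a < y2 ->
  (forall z, crect x1 x2 y1 y2 z -> differentiable g z) -> g a = 0 ->
  rint (fun z => g z / (z - a)) x1 x2 y1 y2 = 0.
Proof.
move=> xa ya dg ga.
have aQ : crect x1 x2 y1 y2 a.
  by case/andP: xa ya => h1 h2 /andP[h3 h4]; split; rewrite !ltW.
have /nbhs_ballP[d /= d0 dP] := diff_approx (dg a aQ) ltr01.
pose c : C := 'd g a 1.
apply: (rint_removable (M := N (`|c| + 1)) xa ya _ d0).
  move=> z zQ za; apply: differentiableM; first exact: dg.
  apply: differentiableV; last by rewrite subr_eq0.
  exact: differentiableB.
move=> z zd za; rewrite -norm_Re normrM normfV ler_pdivrMr ?normr_gt0 ?subr_eq0//.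
rewrite [X in _ <= X * _]ger0_norm ?addr_ge0//.
have := dP z; rewrite /ball /= distrC => /(_ zd).
rewrite ga subr0 mul1r -[X in 'd _ _ X]mulr1 -[_ * 1]/(_ *: _) linearZ /= => H.
have -> : g z = (g z - (z - a) * c) + (z - a) * c by rewrite subrK.
apply: le_trans (ler_normD _ _) _; rewrite [leRHS]mulrDl mul1r [leRHS]addrC; apply: lerD => //.
by rewrite normrM mulrC.
Qed.

End Removable.

(** * Descent through the standard fold *)

Lemma norm_primitive_root (K : numDomainType) (k : nat) (z : K) :
  k.-primitive_root z -> `|z| = 1.
Proof.
move=> zk; apply/eqP; rewrite -(@pexpr_eq1 _ _ k) ?normr_ge0 ?prim_order_gt0//.
  by rewrite -normrX prim_expr_order// normr1.
exact: prim_order_gt0 zk.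
Qed.

(** As (z^j a)^k = a^k, factoring a difference of k-th powers puts every summand over the common
    denominator w^k - a^k. In the numerators, summing over j kills each power a^i with 0 < i < k,
    because the powers of z^i sum to 0. For a = 0 the k poles coincide and the identity still
    holds. *)
Lemma kernel_sum (F : fieldType) (k : nat) (z w a : F) : k.-primitive_root z ->
  w ^+ k != a ^+ k ->
  \sum_(j < k) (w - z ^+ j * a)^-1 = k%:R * w ^+ k.-1 / (w ^+ k - a ^+ k).
Proof.
move=> zk wa; have k0 := prim_order_gt0 zk.
have E j : (w - z ^+ j * a)^-1 =
    (\sum_(i < k) w ^+ (k.-1 - i) * (z ^+ j * a) ^+ i) / (w ^+ k - a ^+ k).
  have H : w ^+ k - a ^+ k = (w - z ^+ j * a) * \sum_(i < k) w ^+ (k.-1 - i) * (z ^+ j * a) ^+ i.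
    rewrite -{1}(prednK k0) -[X in _ - X]mul1r -(expr1n _ j) -(prim_expr_order zk) exprAC -exprMn.
    rewrite -[X in _ - _ ^+ X](prednK k0) subrXX (prednK k0).
    by congr (_ * _); apply: eq_bigr => i _; rewrite subSS.
  have h0 : w ^+ k - a ^+ k != 0 by rewrite subr_eq0.
  have [h1 h2] : w - z ^+ j * a != 0 /\ \sum_(i < k) w ^+ (k.-1 - i) * (z ^+ j * a) ^+ i != 0.
    by move: h0; rewrite H mulf_eq0 negb_or => /andP[].
  by rewrite H invfM mulrCA divff// mulr1.
under eq_bigr do rewrite E.
rewrite -mulr_suml exchange_big /=; congr (_ / _).
rewrite (bigD1 (Ordinal k0)) //= [X in _ + X]big1 ?addr0 => [|i i0].
  under eq_bigr do rewrite subn0 expr0 mulr1.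
  by rewrite sumr_const card_ord mulr_natl.
rewrite -mulr_sumr.
under eq_bigr do rewrite exprMn -exprM mulnC exprM.
rewrite -mulr_suml.
suff -> : \sum_(j < k) z ^+ i ^+ j = 0 by rewrite mul0r mulr0.
have zi : z ^+ i - 1 != 0.
  rewrite subr_eq0 -(prim_order_dvd zk) gtnNdvd//.
  by rewrite lt0n; apply: contraNneq i0 => i0; apply/eqP/val_inj.
by apply: (mulfI zi); rewrite -subrX1 mulr0 exprAC (prim_expr_order zk) expr1n subrr.
Qed.

Lemma continuous_sum_ord (K : numFieldType) (n : nat) (h : 'I_n -> K -> K) (w : K) :
  (forall j, {for w, continuous (h j)}) -> {for w, continuous (fun w => \sum_(j < n) h j w)}.
Proof.
elim: n h => [|n IH] h ch.
  have -> : (fun w => \sum_(j < 0) h j w) = cst 0 by apply/funext => u; rewrite big_ord0.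
  exact: cst_continuous.
have -> : (fun w => \sum_(j < n.+1) h j w) =
    (fun w => h ord0 w + \sum_(j < n) h (lift ord0 j) w).
  by apply/funext => u; rewrite big_ord_recl.
by apply: (@cvgD K K^o _ (nbhs w) _ (h ord0)) => //; [exact: ch|exact: IH].
Qed.

(** * Contour integrals depending on a parameter *)

Section ParametricIntegrals.
Local Open Scope complex_scope.
Variable R : realType.
Local Notation C := (cplx R).
Implicit Types (z w a : C) (f g : C -> C).
Local Notation N z := (complex.Re (`|z| : C)).

Lemma eq_rint f g (x1 x2 y1 y2 : R) : x1 <= x2 -> y1 <= y2 ->
  {in cbdry x1 x2 y1 y2, f =1 g} -> rint f x1 x2 y1 y2 = rint g x1 x2 y1 y2.
Proof.
move=> x12 y12 fg; have [b1 b2 b3 b4] := cbdry_sides x12 y12.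
have {}fg w : cbdry x1 x2 y1 y2 w -> f w = g w by move=> ?; rewrite fg// inE.
rewrite /rint; congr (_ - _ + _ * (_ - _)); apply: eq_cint => t; rewrite in_itv /= => tt;
  apply: fg;
  [apply: b1|apply: b2|apply: b4|apply: b3]; by rewrite /crect /= lexx.
Qed.

Lemma rint_sum0 n (h : 'I_n -> C -> C) (x1 x2 y1 y2 : R) : x1 <= x2 -> y1 <= y2 ->
  (forall j, continuous_on (cbdry x1 x2 y1 y2) (h j)) ->
  (forall j, rint (h j) x1 x2 y1 y2 = 0) ->
  rint (fun w => \sum_(j < n) h j w) x1 x2 y1 y2 = 0.
Proof.
move=> x12 y12; elim: n h => [|n IH] h ch h0.
  rewrite -[RHS](rint_affine 0 0 x12 y12); apply: eq_rint => // w _.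
  by rewrite big_ord0 mul0r addr0.
have cs : continuous_on (cbdry x1 x2 y1 y2) (fun w => \sum_(j < n) h (lift ord0 j) w).
  by move=> w wb; apply: continuous_sum_ord => j; exact: ch.
have := rintD x12 y12 (ch ord0) cs.
have -> := IH (fun j => h (lift ord0 j)) (fun j => ch _) (fun j => h0 _).
rewrite (h0 ord0) addr0 => E; rewrite -[RHS]E.
by apply: eq_rint => // w _; rewrite big_ord_recl.
Qed.

(** A tube lemma: compactness of the segment turns joint continuity at the points over [b0] into
    closeness uniform along the segment. *)
Lemma near_segment (T : topologicalType) (b0 : T) (h : R -> T -> C) (x1 x2 : R) (e : C) :
  (forall x, x1 <= x <= x2 -> {for (x, b0), continuous (fun u => h u.1 u.2)}) -> 0 < e ->
  \forall y \near b0, forall x, x1 <= x <= x2 -> `|h x y - h x b0| <= e.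
Proof.
move=> ch e0.
have e2 : 0 < e / 2 by rewrite divr_gt0.
have P x : x1 <= x <= x2 -> \forall x' \near x & y \near b0, `|h x' y - h x' b0| <= e.
  move=> xx; have /(_ (ball (h x b0) (e / 2)) (nbhsx_ballx _ _ e2)) := ch x xx.
  case=> -[A B] /= [nA nB] AB; exists (A, B) => // -[x' y] /= [Ax' By].
  have /= h1 : ball (h x b0) (e / 2) (h x' y) by apply: (AB (x', y)).
  have /= h2 : ball (h x b0) (e / 2) (h x' b0).
    by apply: (AB (x', b0)); split => //; exact: nbhs_singleton.
  have -> : h x' y - h x' b0 = (h x b0 - h x' b0) - (h x b0 - h x' y) by ring.
  by rewrite [e]splitr (le_trans (ler_normB _ _))// lerD// ltW.
have cov := (@compact_near_coveringP R `[x1, x2]).1 (@segment_compact R x1 x2).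
have H := cov T (nbhs b0) (fun t x => `|h x t - h x b0| <= e) (nbhs_filter b0).
apply: filterS (H _) => [y Hy x xx|x].
  by apply: Hy; rewrite /= in_itv.
by rewrite /= in_itv /=; exact: P.
Qed.

(** Uniform closeness on the four sides bounds the difference of the integrals. Joint continuity is
    assumed only over [b0], so integrability of the nearby slices comes from the separate last
    hypothesis. *)
Lemma rint_cvg (T : topologicalType) (b0 : T) (h : C -> T -> C) (x1 x2 y1 y2 : R) :
  x1 <= x2 -> y1 <= y2 ->
  (forall w, cbdry x1 x2 y1 y2 w -> {for (w, b0), continuous (fun u => h u.1 u.2)}) ->
  (\forall y \near b0, continuous_on (cbdry x1 x2 y1 y2) (h ^~ y)) ->
  rint (h ^~ y) x1 x2 y1 y2 @[y --> b0] --> rint (h ^~ b0) x1 x2 y1 y2.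
Proof.
move=> x12 y12 ch cy; have cb := nbhs_singleton cy.
have [b1 b2 b3 b4] := cbdry_sides x12 y12.
pose D := (x2 - x1) + (y2 - y1); have D0 : 0 <= D by rewrite addr_ge0 ?subr_ge0.
have near_side (e : C) : 0 < e -> \forall y \near b0, forall w, cbdry x1 x2 y1 y2 w ->
    `|h w y - h w b0| <= e.
  move=> e0.
  have Hh y0 : crect x1 x2 y0 y0 `<=` cbdry x1 x2 y1 y2 ->
      \forall y \near b0, forall x, x1 <= x <= x2 -> `|h (x +i* y0) y - h (x +i* y0) b0| <= e.
    move=> sub; apply: (@near_segment T b0 (fun x => h (x +i* y0))) => // x xx.
    have hb : cbdry x1 x2 y1 y2 (x +i* y0) by apply: sub; rewrite /crect /= lexx.
    apply: (@continuous_comp _ _ _ (fun u : R * T => ((u.1 +i* y0 : C), u.2)) (fun u =>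
      h u.1 u.2)).
      apply: (@cvg_pair _ C T _ (nbhs (x +i* y0 : C)) (nbhs b0)); last exact: cvg_snd.
      by apply: (@cvg_comp _ R C fst (fun x => x +i* y0) _ (nbhs x));
        [exact: cvg_fst|exact: Complex_continuousl].
    exact: ch.
  have Hv x0 : crect x0 x0 y1 y2 `<=` cbdry x1 x2 y1 y2 ->
      \forall y \near b0, forall x, y1 <= x <= y2 -> `|h (x0 +i* x) y - h (x0 +i* x) b0| <= e.
    move=> sub; apply: (@near_segment T b0 (fun x => h (x0 +i* x))) => // x xx.
    have hb : cbdry x1 x2 y1 y2 (x0 +i* x) by apply: sub; rewrite /crect /= lexx.
    apply: (@continuous_comp _ _ _ (fun u : R * T => ((x0 +i* u.1 : C), u.2)) (fun u =>
      h u.1 u.2)).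
      apply: (@cvg_pair _ C T _ (nbhs (x0 +i* x : C)) (nbhs b0)); last exact: cvg_snd.
      by apply: (@cvg_comp _ R C fst (fun y => x0 +i* y) _ (nbhs x));
        [exact: cvg_fst|exact: Complex_continuousr].
    exact: ch.
  near=> y; case=> wx wy [[]]; rewrite /= => /andP[wx1 wx2] /andP[wy1 wy2] [|||] E; subst.
  - by apply: (near (Hv _ b3) y) => //; rewrite wy1.
  - by apply: (near (Hv _ b4) y) => //; rewrite wy1.
  - by apply: (near (Hh _ b1) y) => //; rewrite wx1.
  - by apply: (near (Hh _ b2) y) => //; rewrite wx1.
apply/(@cvgrPdist_le C C) => e e0.
have eE : e = (complex.Re e)%:C by rewrite RRe_real// gtr0_real.
have eR : 0 < complex.Re e by rewrite -ltcR -eE.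
pose d := complex.Re e / (D *+ 4 + 1).
have D4 : 0 < D *+ 4 + 1 by apply: ltr_wpDl => //; exact: mulrn_wge0.
have d0 : (0 : C) < d%:C by rewrite ltcR divr_gt0.
apply: filterS2 cy (near_side _ d0) => y {}cy hy.
pose g w := h w y - h w b0.
have cg : continuous_on (cbdry x1 x2 y1 y2) g.
  by move=> w wb; exact: (@cvgB C C C (nbhs w) _ _ _ _ _ (cy w wb) (cb w wb)).
have -> : rint (h ^~ y) x1 x2 y1 y2 = rint (h ^~ b0) x1 x2 y1 y2 + rint g x1 x2 y1 y2.
  by rewrite -(rintD x12 y12 cb cg); apply: eq_rint => // w _; rewrite /g subrKC.
rewrite opprD addrA subrr add0r normrN eE; apply: le_trans (rint_le x12 y12 cg hy) _.
rewrite lecR -/D -mulrnAr /d mulrAC ler_pdivrMr// ler_pM2l// lerDl//.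
Unshelve. all: by end_near. Qed.

End ParametricIntegrals.

Lemma exprn_differentiable (K : numFieldType) (n : nat) (x : K) :
  differentiable (fun w : K => w ^+ n) x.
Proof.
case: n => [|n]; first exact: differentiable_cst.
by have := @differentiableX K K id n x; rewrite exprfctE; apply.
Qed.

(** * The averaged Cauchy kernel on a square centred at 0 *)

Section Winding.
Local Open Scope complex_scope.
Variable R : realType.
Local Notation C := (cplx R).
Local Notation mu := (@lebesgue_measure R).

Lemma Rint_cst_le (a b : R) (f : R -> R) (M : R) : a <= b -> mu.-integrable `[a, b] (EFin \o f) ->
  (forall x, a <= x <= b -> M <= f x) -> M * (b - a) <= \int[mu]_(x in `[a, b]) f x.
Proof.
move=> ab fi fM; rewrite -(Rint_cst M ab); apply: le_Rintegral => //.
  apply: continuous_compact_integrable; first exact: segment_compact.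
  exact: cst_continuous.
Qed.

Lemma Rint_le_cst (a b : R) (f : R -> R) (M : R) : a <= b -> mu.-integrable `[a, b] (EFin \o f) ->
  (forall x, a <= x <= b -> f x <= M) -> \int[mu]_(x in `[a, b]) f x <= M * (b - a).
Proof.
move=> ab fi fM; rewrite -(Rint_cst M ab); apply: le_Rintegral => //.
  apply: continuous_compact_integrable; first exact: segment_compact.
  exact: cst_continuous.
Qed.

Lemma Im_rint (f : C -> C) (x1 x2 y1 y2 : R) : complex.Im (rint f x1 x2 y1 y2) =
  \int[mu]_(x in `[x1, x2]) complex.Im (f (x +i* y1)) -
  \int[mu]_(x in `[x1, x2]) complex.Im (f (x +i* y2)) +
  (\int[mu]_(y in `[y1, y2]) complex.Re (f (x2 +i* y)) -
   \int[mu]_(y in `[y1, y2]) complex.Re (f (x1 +i* y))).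
Proof. by rewrite /rint !ImD ImM !ReD ReN !ImN /= mul0r add0r mul1r. Qed.

Lemma cbdry_square_ge (rho : R) (w : C) : 0 < rho ->
  cbdry (- rho) rho (- rho) rho w -> rho%:C <= `|w|.
Proof.
move=> r0 [_ []] E; [have := normc_ge_Re w|have := normc_ge_Re w|have := normc_ge_Im w|have :=
  normc_ge_Im w];
  by rewrite E ?normrN gtr0_norm.
Qed.

Lemma cbdry_square_neq0 (rho : R) (w : C) : 0 < rho ->
  cbdry (- rho) rho (- rho) rho w -> w != 0.
Proof.
move=> r0 /(cbdry_square_ge r0) h; rewrite -normr_gt0; apply: lt_le_trans h.
by rewrite ltcR.
Qed.

(* Only the sign of the imaginary part is needed: each of the four sides of the
   square contributes a positive amount. *)
Lemma rint_inv_neq0 (rho : R) : 0 < rho ->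
  rint (fun w : C => w^-1) (- rho) rho (- rho) rho != 0.
Proof.
move=> r0; have rr : - rho <= rho by rewrite ge0_cp// ltW.
have cf : continuous_on (cbdry (- rho) rho (- rho) rho) (fun w : C => w^-1).
  by move=> w /(cbdry_square_neq0 r0) w0; exact: inv_continuous.
have [f1 f2 f3 f4] := rcontinuous_bdry rr rr cf.
have q0 x : 0 < x ^+ 2 + rho ^+ 2 by apply: ltr_wpDl; [exact: sqr_ge0|exact: exprn_gt0].
have q1 x : - rho <= x <= rho -> x ^+ 2 + rho ^+ 2 <= 2 * rho ^+ 2.
  rewrite -ler_norml => xr; rewrite mulr_natl mulr2n lerD2r -[x ^+ 2]real_normK ?num_real//.
  by rewrite lerXn2r ?nnegrE// ltW.
have q2 x : - rho <= x <= rho -> (2 * rho)^-1 <= rho / (x ^+ 2 + rho ^+ 2).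
  move=> xr; rewrite ler_pdivlMr// mulrC ler_pdivrMr ?mulr_gt0//.
  by apply: le_trans (q1 x xr) _; rewrite expr2 mulrCA.
have h0 : 0 < (2 * rho)^-1 * (rho - - rho).
  by rewrite mulr_gt0 ?invr_gt0 ?mulr_gt0// opprK addr_gt0.
have g1 : (2 * rho)^-1 * (rho - - rho) <=
  \int[mu]_(x in `[- rho, rho]) complex.Im ((x +i* - rho : C)^-1).
  apply: Rint_cst_le => //; first exact: rcontinuous_Im f1.
  by move=> x xr; rewrite /= mulNr opprK sqrrN; exact: q2.
have g2 : \int[mu]_(x in `[- rho, rho]) complex.Im ((x +i* rho : C)^-1) <=
  - (2 * rho)^-1 * (rho - - rho).
  apply: Rint_le_cst => //; first exact: rcontinuous_Im f2.
  by move=> x xr; rewrite /= lerN2; exact: q2.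
have g3 : \int[mu]_(y in `[- rho, rho]) complex.Re ((- rho +i* y : C)^-1) <=
  - (2 * rho)^-1 * (rho - - rho).
  apply: Rint_le_cst => //; first exact: rcontinuous_Re f3.
  by move=> x xr; rewrite /= mulNr lerN2 sqrrN addrC; exact: q2.
have g4 : (2 * rho)^-1 * (rho - - rho) <=
  \int[mu]_(y in `[- rho, rho]) complex.Re ((rho +i* y : C)^-1).
  apply: Rint_cst_le => //; first exact: rcontinuous_Re f4.
  by move=> x xr; rewrite /= addrC; exact: q2.
apply/eqP => /(congr1 (@complex.Im R)); rewrite Im_rint /=.
move: h0 g1 g2 g3 g4; rewrite !mulNr; clear.
move: (\int[mu]_(x in _) _) (\int[mu]_(x in _) _) (\int[mu]_(x in _) _) (\int[mu]_(x in _) _)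
  (_ * _).
by move=> ? ? ? ? ?; lra.
Qed.

(** The logarithmic derivative of w^k - A. By [kernel_sum] it is the sum of the Cauchy kernels at
    the k-th roots of [A], and it involves [A] alone, with no choice of a root. *)
Definition kernel (k : nat) (A w : C) : C := k%:R * w ^+ k.-1 / (w ^+ k - A).

Lemma norm_lt_neq (rho : R) (k : nat) (A w : C) : (0 < k)%N -> 0 < rho -> `|A| < rho%:C ^+ k ->
  cbdry (- rho) rho (- rho) rho w -> w ^+ k - A != 0.
Proof.
move=> k0 r0 Ar /(cbdry_square_ge r0) wr; rewrite subr_eq0; apply/eqP => wA.
have rC : 0 <= (rho%:C : C) by rewrite ler0c ltW.
have : `|A| < `|A|.
  by apply: (lt_le_trans Ar); rewrite -wA normrX; apply: lerXn2r => //; rewrite nnegrE.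
by rewrite ltxx.
Qed.

Lemma kernel_continuous (rho : R) (k : nat) (A w : C) : (0 < k)%N -> 0 < rho -> `|A|
  < rho%:C ^+ k ->
  cbdry (- rho) rho (- rho) rho w -> {for w, continuous (kernel k A)}.
Proof.
move=> k0 r0 Ar wb; apply: differentiable_continuous.
have h := norm_lt_neq k0 r0 Ar wb.
apply: differentiableM.
  by apply: differentiableM => //; exact: exprn_differentiable.
by apply: differentiableV => //; apply: differentiableB => //; exact: exprn_differentiable.
Qed.

(** At [A = 0] the kernel is k / w. Continuity in [A] later spreads the non-vanishing to small
    [A]. *)
Lemma rint_kernel0 (rho : R) (k : nat) : (0 < k)%N -> 0 < rho ->
  rint (kernel k 0) (- rho) rho (- rho) rho != 0.
Proof.
move=> k0 r0; have rr : - rho <= rho by rewrite ge0_cp// ltW.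
have -> : rint (kernel k 0) (- rho) rho (- rho) rho = rint (fun w =>
  k%:R * w^-1) (- rho) rho (- rho) rho.
  apply: eq_rint => // w; rewrite inE => /(cbdry_square_neq0 r0) w0.
  by rewrite /kernel subr0 -[X in _ / _ ^+ X](prednK k0) exprSr invfM mulrA mulfK ?expf_neq0.
rewrite rintZ//; first by rewrite mulf_neq0 ?rint_inv_neq0// pnatr_eq0 -lt0n.
by move=> w /(cbdry_square_neq0 r0) w0; exact: inv_continuous.
Qed.

(** [kernel_sum] splits the integrand into k quotients, and [cauchy_zero] applies to each, all the
    poles z^j a having the norm of [a] and so lying inside the square. *)
Lemma cauchy_kernel_zero (rho : R) (k : nat) (z a : C) (g : C -> C) : k.-primitive_root z ->
  0 < rho ->
  (forall w, crect (- rho) rho (- rho) rho w -> differentiable g w) ->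
  `|a| < rho%:C -> (forall j : nat, g (z ^+ j * a) = 0) ->
  rint (fun w => g w * kernel k (a ^+ k) w) (- rho) rho (- rho) rho = 0.
Proof.
move=> zk r0 dg ar ga; have k0 := prim_order_gt0 zk.
have rr : - rho <= rho by rewrite ge0_cp// ltW.
have nz := norm_primitive_root zk.
have na (j : nat) : `|z ^+ j * a| = `|a| by rewrite normrM normrX nz expr1n mul1r.
have aI (j : nat) : - rho < complex.Re (z ^+ j * a) < rho /\ - rho < complex.Im (z ^+ j * a) <
  rho.
  rewrite -!ltr_norml -!ltcR; split; apply: (le_lt_trans _ ar); rewrite -(na j).
    exact: normc_ge_Re.
  exact: normc_ge_Im.
have -> : rint (fun w => g w * kernel k (a ^+ k) w) (- rho) rho (- rho) rho =
   rint (fun w => \sum_(j < k) g w / (w - z ^+ j * a)) (- rho) rho (- rho) rho.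
  apply: eq_rint => // w; rewrite inE => wb; rewrite -mulr_sumr kernel_sum//.
  rewrite -subr_eq0; apply: (norm_lt_neq k0 r0 _ wb).
  by rewrite normrX ltrXn2r ?nnegrE// ?ler0c ?(ltW r0)// -lt0n.
apply: rint_sum0 => // j.
  move=> w wb; apply: differentiable_continuous; apply: differentiableM.
    by apply: dg; exact: cbdry_sub wb.
  apply: differentiableV; last first.
    rewrite subr_eq0; apply/eqP => E.
    by have := cbdry_square_ge r0 wb; rewrite E na; move/(lt_le_trans ar); rewrite ltxx.
  exact: differentiableB.
by have [h1 h2] := aI j; apply: cauchy_zero.
Qed.

End Winding.

(** * Differentiability criteria and replacement of one coordinate *)

Section DiffUtilities.
Variable K : numFieldType.

Lemma near_eq_differentiable (V W : normedModType K) (f g : V -> W) (x : V) :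
  (\forall y \near x, f y = g y) -> differentiable g x -> differentiable f x.
Proof.
move=> fg dg; apply: (approx_diff (df := 'd g x)); first exact: diff_continuous.
move=> e e0; have fgx := nbhs_singleton fg.
by apply: filterS2 fg (diff_approx dg e0) => y -> ; rewrite fgx.
Qed.

Lemma littleo_differentiable (V W : normedModType K) (f : V -> W) (x : V) :
  (forall e : K, 0 < e -> \forall y \near x, `|f y - f x| <= e * `|y - x|) ->
  differentiable f x.
Proof.
(* The zero linear map is supplied as the differential of a constant, which brings its continuity
   along. *)
move=> H; have c0 := differentiable_cst (0 : W) x.
apply: (approx_diff (df := 'd (cst (0 : W)) x)); first exact: diff_continuous.
by move=> e e0; apply: filterS (H e e0) => y; rewrite diff_cst subr0.
Qed.

Lemma rV_coord_norm_le (n : nat) (x : 'rV[K]_n) (j : 'I_n) : `|x 0 j| <= `|x|.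
Proof.
apply/ler_addgt0Pr => e e0.
have : ball (0 : 'rV[K]_n) (`|x| + e) x.
  by rewrite -ball_normE /= sub0r normrN ltrDl.
move=> [_ /(_ 0 j)].
by rewrite /ball /= mxE sub0r normrN => /ltW.
Qed.

Lemma rV_norm_lt (n : nat) (x : 'rV[K]_n) (e : K) : 0 < e ->
  (forall j, `|x 0 j| < e) -> `|x| < e.
Proof.
move=> e0 H.
have : ball (0 : 'rV[K]_n) e x.
  by split=> // i j; rewrite (ord1 i) /ball /= mxE sub0r normrN.
by rewrite -ball_normE /= sub0r normrN.
Qed.

End DiffUtilities.

Section Update.
Variables (K : numFieldType) (n : nat).
Local Notation V := 'rV[K]_n.+1.
Implicit Types (w v : K) (y : V).

(** Replacement of the first coordinate, written as a sum rather than by cases on the index so that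
    continuity and differentiability follow from the algebraic rules. *)
Definition upd (w : K) (y : V) : V := y + (w - y 0 0) *: delta_mx 0 0.

Lemma updE w y j : upd w y 0 j = if j == 0 then w else y 0 j.
Proof.
rewrite !mxE eqxx /=; case: eqP => [->|_]; last by rewrite mulr0 addr0.
by rewrite mulr1 subrKC.
Qed.

Lemma upd_id y : upd (y 0 0) y = y.
Proof. by rewrite /upd subrr scale0r addr0. Qed.

Lemma upd_upd w v y : upd w (upd v y) = upd w y.
Proof. by apply/rowP => j; rewrite !updE; case: eqP. Qed.

Lemma upd_lt (e : K) w y : 0 < e -> `|w| < e -> `|y| < e -> `|upd w y| < e.
Proof.
move=> e0 we ye; apply: rV_norm_lt => // j; rewrite updE; case: eqP => // _.
exact: le_lt_trans (rV_coord_norm_le _ _) ye.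
Qed.

Lemma upd_differentiable_l (y : V) (w : K) : differentiable (upd^~ y) w.
Proof.
apply: differentiableD; first exact: differentiable_cst.
by apply: differentiableZl; apply: differentiableB.
Qed.

Lemma upd_differentiable_r (w : K) (y : V) : differentiable (upd w) y.
Proof.
apply: differentiableD; first by [].
apply: differentiableZl; apply: differentiableB => //; exact: differentiable_coord.
Qed.

Lemma upd_continuous (u : K * V) : {for u, continuous (fun u => upd u.1 u.2)}.
Proof.
apply: cvgD; first exact: cvg_snd.
apply: cvgZl; apply: (@cvgB K K^o _ (nbhs u) _ fst (fun u => u.2 0 0)); first exact: cvg_fst.
apply: (@cvg_comp _ _ _ snd (fun y : V => y 0 0) _ (nbhs u.2)); first exact: cvg_snd.
exact: coord_continuous.
Qed.

End Update.

Lemma continuous_at_scale (K : numFieldType) (T : topologicalType) (c : K) (g : T -> K) (x : T) :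
  {for x, continuous g} -> {for x, continuous (fun t => c * g t)}.
Proof. by move=> cg; apply: cvgM => //; exact: cvg_cst. Qed.

Lemma pair_continuousl (T U : topologicalType) (y : U) : continuous (fun w : T => (w, y)).
Proof.
move=> w; apply: (@cvg_pair _ T U _ (nbhs w) (nbhs y)); last exact: cvg_cst.
exact: cvg_id.
Qed.

Lemma continuous_at_mul (K : numFieldType) (T : topologicalType) (f g : T -> K) (x : T) :
  {for x, continuous f} -> {for x, continuous g} -> {for x, continuous (fun t => f t * g t)}.
Proof. by move=> cf cg; exact: cvgM. Qed.

(** Replacing [J y] by [J b] leaves a differentiable function, and the error is o(|y - b|) because
    the first factor is at most |y - b| and [J y - J b] tends to 0. This is how a merely continuous
    divided difference yields a derivative. *)
Lemma differentiable_coordB_mul (K : numFieldType) (n : nat) (b : 'rV[K]_n) (j : 'I_n)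
    (J : 'rV[K]_n -> K) : {for b, continuous J} ->
  differentiable (fun y : 'rV[K]_n => (y 0 j - b 0 j) * J y) b.
Proof.
move=> cJ.
have -> : (fun y : 'rV[K]_n => (y 0 j - b 0 j) * J y) =
    (fun y : 'rV[K]_n => (y 0 j - b 0 j) * J b + (y 0 j - b 0 j) * (J y - J b)).
  by apply/funext => y; rewrite -mulrDr subrKC.
apply: differentiableD.
  apply: differentiableM; last exact: differentiable_cst.
  exact: (differentiableB (differentiable_coord b 0 j) (differentiable_cst _ _)).
apply: littleo_differentiable => e e0.
rewrite !subrr !mulr0.
have /(@cvgrPdist_le K K) /(_ e e0) := cJ; apply: filterS => y Hy.
rewrite subr0 normrM mulrC; apply: ler_pM => //; first by rewrite distrC.
by have := rV_coord_norm_le (y - b) j; rewrite !mxE.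
Qed.

(** The pointwise identity between integrands behind [descended_eq]: [q] is [kernel2], [u] and [v]
    are the kernels at [y 0 0] and [b 0 0], and [f1], [f2], [f3] are the values of [f] with first
    coordinate w, x0 and a. *)
Lemma kernel_rearrange (K : comRingType) (q u v f1 f2 f3 d : K) : d * q = u - v ->
  d * ((f1 - f2) * q) + (f1 - f2) * v = (f1 - f3) * u + (f3 - f2) * u.
Proof. by move=> E; rewrite mulrCA E; ring. Qed.

(** * Holomorphy of the descended function *)

Section Descent.
Local Open Scope complex_scope.
Variable R : realType.
Local Notation C := (cplx R).
Variables (m k : nat) (z : C) (r : C) (rho : R).
Local Notation V := 'rV[C]_m.+1.
Variable f : V -> C.
Hypothesis zk : k.-primitive_root z.
Hypothesis df : forall x : V, `|x| < r -> differentiable f x.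
Hypothesis fz : forall x : V, `|x| < r -> f (upd (z * x 0 0) x) = f x.
Hypothesis rho0 : 0 < rho.
(** Points of the square of half-side [rho] have norm at most |Re| + |Im| <= 2 rho, hence lie where
    [f] is controlled. *)
Hypothesis rhor : (rho *+ 2)%:C < r.
Local Notation Q := (crect (- rho) rho (- rho) rho : set C).
Local Notation bQ := (cbdry (- rho) rho (- rho) rho : set C).
Local Notation oint h := (rint h (- rho) rho (- rho) rho).

Let rr : - rho <= rho. Proof. by rewrite ge0_cp// ltW. Qed.

Let r0 : 0 < r.
Proof. by apply: le_lt_trans rhor; rewrite ler0c mulrn_wge0// ltW. Qed.

Let k0 : (0 < k)%N. Proof. exact: prim_order_gt0 zk. Qed.

Let rho_r : rho%:C < r.
Proof. by apply: le_lt_trans rhor; rewrite lecR mulr2n lerDl ltW. Qed.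

Let Q_lt w : Q w -> `|w| < r.
Proof.
move=> [wx wy]; apply: le_lt_trans rhor; apply: (le_trans (normc_le_ReIm w)).
by rewrite lecR mulr2n lerD// ler_norml.
Qed.

Let root_lt (A a : C) : a ^+ k = A -> `|A| < rho%:C ^+ k -> `|a| < rho%:C.
Proof. by move=> <-; rewrite normrX ltr_pXn2r// nnegrE// ler0c ltW. Qed.

Let fzj (j : nat) (a : C) (y : V) : `|a| < r -> `|y| < r ->
  f (upd (z ^+ j * a) y) = f (upd a y).
Proof.
move=> ar yr; have nz := norm_primitive_root zk.
elim: j => [|j <-]; first by rewrite expr0 mul1r.
have h : `|upd (z ^+ j * a) y| < r.
  by apply: upd_lt => //; rewrite normrM normrX nz expr1n mul1r.
by rewrite -[RHS](fz h) upd_upd updE eqxx mulrA exprS.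
Qed.

Let slice w (y : V) : Q w -> `|y| < r -> differentiable (fun w => f (upd w y)) w.
Proof.
move=> wQ yr; apply: (@differentiable_comp C C V C (fun w => upd w y) f w).
  exact: upd_differentiable_l.
by apply: df; apply: upd_lt => //; exact: Q_lt.
Qed.

(** [k.-root] is one branch, with no continuity claimed. Near 0, invariance of [f] gives the same
    value for every other k-th root, and the holomorphy proof rests on this. *)
Definition descended (y : V) : C := f (upd (k.-root (y 0 0)) y).

(** The second condition puts the k-th roots of the first coordinate inside the contour; the third
    permits division in [descended_eq]. *)
Let good (y : V) := [/\ `|y| < r, `|y 0 0| < rho%:C ^+ k & oint (kernel k (y 0 0)) != 0].

(** The difference quotient of [kernel] in its parameter, in a form that stays meaningful and
    continuous at [A = B]. *)
Definition kernel2 (A B w : C) : C := k%:R * w ^+ k.-1 / ((w ^+ k - A) * (w ^+ k - B)).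

Let kernel2E (A B w : C) : w ^+ k - A != 0 -> w ^+ k - B != 0 ->
  (A - B) * kernel2 A B w = kernel k A w - kernel k B w.
Proof.
rewrite /kernel2 /kernel; move: (k%:R * w ^+ k.-1) (w ^+ k) => u v h1 h2.
by field; rewrite h1 h2.
Qed.

Let kernel2_continuous w (A B : C) : `|A| < rho%:C ^+ k -> `|B| < rho%:C ^+ k -> bQ w ->
  {for (w, A), continuous (fun u => kernel2 u.2 B u.1)}.
Proof.
move=> Ar Br wb.
have hA := norm_lt_neq k0 rho0 Ar wb; have hB := norm_lt_neq k0 rho0 Br wb.
have c1 (n : nat) : {for (w, A), continuous (fun u : C * C => u.1 ^+ n)}.
  apply: (@cvg_comp _ _ _ fst (fun w : C => w ^+ n) _ (nbhs w)); first exact: cvg_fst.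
  exact: (differentiable_continuous (exprn_differentiable n w)).
apply: cvgM.
  by apply: cvgM; [exact: cvg_cst|exact: c1].
apply: cvgV; first by rewrite /= mulf_neq0.
apply: cvgM.
  by apply: (@cvgB C C _ (nbhs (w, A)) _ _ snd); [exact: c1|exact: cvg_snd].
by apply: (@cvgB C C _ (nbhs (w, A)) _ _ (cst B)); [exact: c1|exact: cvg_cst].
Qed.

Let kernel_joint w (A : C) : `|A| < rho%:C ^+ k -> bQ w ->
  {for (w, A), continuous (fun u => kernel k u.2 u.1)}.
Proof.
move=> Ar wb; have hA := norm_lt_neq k0 rho0 Ar wb.
have c1 (n : nat) : {for (w, A), continuous (fun u : C * C => u.1 ^+ n)}.
  apply: (@cvg_comp _ _ _ fst (fun w : C => w ^+ n) _ (nbhs w)); first exact: cvg_fst.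
  exact: (differentiable_continuous (exprn_differentiable n w)).
apply: cvgM.
  by apply: cvgM; [exact: cvg_cst|exact: c1].
apply: cvgV; first by [].
by apply: (@cvgB C C _ (nbhs (w, A)) _ _ snd); [exact: c1|exact: cvg_snd].
Qed.

(* With [x0] fixed, the integrand minus [f (upd x0 y)] vanishes at the k-th roots
   of [b 0 0], so its integral against [kernel k (b 0 0)] is zero. *)
Let descended_eq (b y : V) (x0 a : C) : good b -> good y ->
  x0 ^+ k = b 0 0 -> a ^+ k = y 0 0 ->
  (f (upd a y) - f (upd x0 y)) * oint (kernel k (y 0 0)) =
  (y 0 0 - b 0 0) *
  oint (fun w => (f (upd w y) - f (upd x0 y)) * kernel2 (y 0 0) (b 0 0) w).
Proof.
move=> [br bk b0] [yr yk y0] x0k ak.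
have ar : `|a| < rho%:C by exact: root_lt ak yk.
have xr : `|x0| < rho%:C by exact: root_lt x0k bk.
pose G w := f (upd w y) - f (upd x0 y); pose g w := f (upd w y) - f (upd a y).
have dG w : Q w -> differentiable G w by move=> wQ; apply: differentiableB => //; exact: slice.
have dg w : Q w -> differentiable g w by move=> wQ; apply: differentiableB => //; exact: slice.
have cG w : bQ w -> {for w, continuous G}.
  by move=> /cbdry_sub /dG; exact: differentiable_continuous.
have cg w : bQ w -> {for w, continuous g}.
  by move=> /cbdry_sub /dg; exact: differentiable_continuous.
have kc (A : C) : `|A| < rho%:C ^+ k -> continuous_on bQ (kernel k A).
  by move=> Ak w; exact: kernel_continuous.
have I1 : oint (fun w => G w * kernel k (b 0 0) w) = 0.
  have := cauchy_kernel_zero zk rho0 dG xr; rewrite x0k; apply => j.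
  by rewrite /G (fzj _ (lt_trans xr rho_r) yr) subrr.
have I2 : oint (fun w => g w * kernel k (y 0 0) w) = 0.
  have := cauchy_kernel_zero zk rho0 dg ar; rewrite ak; apply => j.
  by rewrite /g (fzj _ (lt_trans ar rho_r) yr) subrr.
pose H w := G w * kernel2 (y 0 0) (b 0 0) w.
have cH : continuous_on bQ H.
  move=> w wb; apply: (continuous_at_mul (cG w wb)).
  apply: (@cvg_comp _ _ _ (fun w : C => (w, y 0 0 : C)) (fun u =>
    kernel2 u.2 (b 0 0) u.1) _ (nbhs (w, y 0 0))).
    exact: pair_continuousl.
  exact: kernel2_continuous.
have c1 : continuous_on bQ (fun w => G w * kernel k (b 0 0) w).
  by move=> w wb; exact: (continuous_at_mul (cG w wb) (kc _ bk w wb)).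
have c2 : continuous_on bQ (fun w => g w * kernel k (y 0 0) w).
  by move=> w wb; exact: (continuous_at_mul (cg w wb) (kc _ yk w wb)).
have c3 : continuous_on bQ (fun w => (y 0 0 - b 0 0) * H w).
  by move=> w wb; exact: (continuous_at_scale (cH w wb)).
have c4 : continuous_on bQ (fun w => (f (upd a y) - f (upd x0 y)) * kernel k (y 0 0) w).
  by move=> w wb; exact: (continuous_at_scale (kc _ yk w wb)).
(* [E1] and [E2] integrate the two sides of [kernel_rearrange]; [I1] and [I2] remove one term from
   each, and the remaining constants come out of the integrals. *)
have E1 := etrans (rintD rr rr c3 c1) (etrans (congr1 (+%R _) I1) (addr0 _)).
have E2 := etrans (rintD rr rr c2 c4) (etrans (congr1 (+%R^~ _) I2) (add0r _)).
have Z1 := etrans E1 (rintZ (y 0 0 - b 0 0) rr rr cH).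
have Z2 := etrans E2 (rintZ (f (upd a y) - f (upd x0 y)) rr rr (kc _ yk)).
apply: (etrans (esym Z2) (etrans _ Z1)); apply: eq_rint => // w; rewrite inE => wb.
exact: (esym (kernel_rearrange _ _ _ (kernel2E (norm_lt_neq k0 rho0 yk wb) (norm_lt_neq k0 rho0
  bk wb)))).
Qed.

Let integrand_continuous (b y : V) w : good b -> good y -> bQ w ->
  {for (w, y), continuous (fun u : C * V =>
    (f (upd u.1 u.2) - f (upd (k.-root (b 0 0)) u.2)) * kernel2 (u.2 0 0) (b 0 0) u.1)}.
Proof.
move=> [br bk b0] [yr yk y0] wb; set x0 := k.-root (b 0 0).
have xr : `|x0| < r by apply: (lt_trans _ rho_r); exact: (root_lt (rootCK k0 _) bk).
apply: cvgM.
  apply: (@cvgB C C _ (nbhs (w, y)) _ (fun u => f (upd u.1 u.2)) (fun u => f (upd x0 u.2))).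
    apply: (@cvg_comp _ _ _ (fun u : C * V => upd u.1 u.2) f _ (nbhs (upd w y))).
      exact: (@upd_continuous C m (w, y)).
    have h : `|upd w y| < r by apply: upd_lt => //; exact/Q_lt/cbdry_sub.
    exact: (differentiable_continuous (df h)).
  apply: (@cvg_comp _ _ _ snd (fun y => f (upd x0 y)) _ (nbhs y)); first exact: cvg_snd.
  have h : differentiable (fun y => f (upd x0 y)) y.
    apply: (@differentiable_comp C V V C (upd x0) f); first exact: upd_differentiable_r.
    by apply: df; exact: upd_lt.
  exact: (differentiable_continuous h).
apply: (@cvg_comp _ _ _ (fun u : C * V => (u.1, u.2 0 0)) (fun u =>
  kernel2 u.2 (b 0 0) u.1) _ (nbhs (w, y 0 0))).
  apply: (@cvg_pair _ C C _ (nbhs w) (nbhs (y 0 0))); first exact: cvg_fst.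
  apply: (@cvg_comp _ _ _ snd (fun y : V => y 0 0) _ (nbhs y)); first exact: cvg_snd.
  exact: coord_continuous.
exact: kernel2_continuous.
Qed.

(** Dividing [descended_eq] by the integral of the kernel gives [descended y = f (upd x0 y) + (y 0 0
    - b 0 0) * J y] near [b]. The root x0 is fixed, so the first term is differentiable; [J] is
    continuous at [b] by [rint_cvg], whether or not [b 0 0] is zero. *)
Let descended_differentiable (b : V) : (\forall y \near b, good y) -> differentiable descended b.
Proof.
move=> gn; have gb := nbhs_singleton gn.
set x0 := k.-root (b 0 0).
pose J (y : V) := oint (fun w => (f (upd w y) - f (upd x0 y)) * kernel2 (y 0 0) (b 0 0) w) /
   oint (kernel k (y 0 0)).
have xr : `|x0| < r by apply: (lt_trans _ rho_r); apply: (root_lt (rootCK k0 _)); case: gb.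
pose D (y : V) := f (upd x0 y) + (y 0 0 - b 0 0) * J y.
apply: (@near_eq_differentiable _ _ _ _ D).
  apply: filterS gn => y gy; have [_ _ y0] := gy.
  rewrite /D /J mulrA -(descended_eq gb gy (rootCK k0 _) (rootCK k0 _)) mulfK//.
  by rewrite subrKC.
pose h1 w (y : V) := (f (upd w y) - f (upd x0 y)) * kernel2 (y 0 0) (b 0 0) w.
pose h2 w (y : V) := kernel k (y 0 0) w.
have j1 w : bQ w -> {for (w, b), continuous (fun u => h1 u.1 u.2)}.
  by move=> wb; exact: integrand_continuous.
have n1 : \forall y \near b, continuous_on bQ (h1^~ y).
  apply: filterS gn => y gy w wb.
  apply: (@cvg_comp _ _ _ (fun w : C => (w, y)) (fun u : C * V => h1 u.1 u.2) _ (nbhs (w, y))).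
    exact: pair_continuousl.
  exact: integrand_continuous.
have c1 := rint_cvg rr rr j1 n1.
have j2 w : bQ w -> {for (w, b), continuous (fun u => h2 u.1 u.2)}.
  move=> wb.
  apply: (@cvg_comp _ _ _ (fun u : C * V => (u.1, u.2 0 0)) (fun u =>
    kernel k u.2 u.1) _ (nbhs (w, b 0 0))).
    apply: (@cvg_pair _ C C _ (nbhs w) (nbhs (b 0 0))); first exact: cvg_fst.
    apply: (@cvg_comp _ _ _ snd (fun y : V => y 0 0) _ (nbhs b)); first exact: cvg_snd.
    exact: coord_continuous.
  by apply: kernel_joint => //; case: gb.
have n2 : \forall y \near b, continuous_on bQ (h2^~ y).
  by apply: filterS gn => y [_ yk _] w wb; exact: kernel_continuous yk wb.
have c2 := rint_cvg rr rr j2 n2.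
have cJ : {for b, continuous J}.
  by apply: (continuous_at_mul c1); apply: (cvgV _ c2); case: gb.
apply: differentiableD; last exact: differentiable_coordB_mul.
apply: (@differentiable_comp C V V C (upd x0) f); first exact: upd_differentiable_r.
by apply: df; apply: upd_lt => //; case: gb.
Qed.

Let good_near0 : \forall y \near (0 : V), good y.
Proof.
have rk : 0 < (rho%:C : C) ^+ k by rewrite exprn_gt0// ltcR.
have n0 : \forall y \near (0 : V), `|y| < r.
  by apply: filterS (near_dist_lt (0 : V) r0) => y; rewrite sub0r normrN.
have nk : nbhs (0 : V) (fun y : V => `|y 0 0| < rho%:C ^+ k).
  apply: filterS (near_dist_lt (0 : V) rk) => y; rewrite sub0r normrN.
  by apply: le_lt_trans; exact: rV_coord_norm_le.
pose h2 w (y : V) := kernel k (y 0 0) w.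
have rk0 : `|(0 : V) 0 0| < (rho%:C : C) ^+ k by rewrite mxE normr0.
have j2 w : bQ w -> {for (w, (0 : V)), continuous (fun u => h2 u.1 u.2)}.
  move=> wb.
  apply: (@cvg_comp _ _ _ (fun u : C * V => (u.1, u.2 0 0)) (fun u => kernel k u.2 u.1) _
    (nbhs (w, (0 : V) 0 0))).
    apply: (@cvg_pair _ C C _ (nbhs w) (nbhs ((0 : V) 0 0))); first exact: cvg_fst.
    apply: (@cvg_comp _ _ _ snd (fun y : V => y 0 0) _ (nbhs (0 : V))); first exact: cvg_snd.
    exact: coord_continuous.
  exact: kernel_joint.
have n2 : \forall y \near (0 : V), continuous_on bQ (h2^~ y).
  by apply: filterS nk => y yk w wb; exact: kernel_continuous yk wb.
have c2 := rint_cvg rr rr j2 n2.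
have c20 : oint (h2^~ (0 : V)) != 0.
  by rewrite /h2 mxE; exact: rint_kernel0.
have n3 : nbhs (0 : V) (fun y : V => oint (kernel k (y 0 0)) != 0).
  exact: (cvgr_neq0 _ c2 c20).
by apply: filterS3 n0 nk n3 => y.
Qed.

Lemma descended_differentiable_near0 : \forall b \near (0 : V), differentiable descended b.
Proof.
(* Differentiability at [b] needs [good] on a neighbourhood of [b], hence the passage to the
   interior. *)
have := nbhs_interior good_near0; apply: filterS => b.
exact: descended_differentiable.
Qed.

End Descent.

Lemma descent (R : realType) (m k : nat) (z : cplx R) (f : 'rV[cplx R]_m.+1 -> cplx R) :
  k.-primitive_root z ->
  (\forall x \near (0 : 'rV[cplx R]_m.+1), differentiable f x) ->
  nbhs (0 : 'rV[cplx R]_m.+1) (fun x : 'rV[cplx R]_m.+1 => f (upd (z * x 0 0) x) = f x) ->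
  \forall x \near (0 : 'rV[cplx R]_m.+1), differentiable (descended k f) x.
Proof.
move=> zk df fz.
have /nbhs_ballP[r /= r0 rP] : nbhs (0 : 'rV[cplx R]_m.+1) (fun x : 'rV[cplx R]_m.+1 =>
    differentiable f x /\ f (upd (z * x 0 0) x) = f x) by apply: filterS2 df fz.
have rE : r = (complex.Re r)%:C%C by rewrite RRe_real// gtr0_real.
have r0' : 0 < complex.Re r by rewrite -ltcR -rE.
have H (x : 'rV[cplx R]_m.+1) : `|x| < r -> differentiable f x /\ f (upd (z * x 0 0) x) = f x.
  by move=> xr; apply: rP; rewrite -ball_normE /= sub0r normrN.
(* Any fraction of [r] below one half serves as [rho]. *)
apply: (@descended_differentiable_near0 R m k z r (complex.Re r / 3)) => //.
- by move=> x /H[].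
- by move=> x /H[].
- by rewrite divr_gt0.
- rewrite [in ltRHS]rE ltcR; lra.
Qed.

(** * Germs and the symmetries of a fold *)

Lemma rV_differentiable (K : numFieldType) (V : normedModType K) (n : nat)
    (F : V -> 'rV[K]_n) (x : V) :
  (forall j, differentiable (fun y => F y 0 j) x) -> differentiable F x.
Proof.
move=> dF.
have -> : F = \sum_(j < n) (fun y => F y 0 j *: (delta_mx 0 j : 'rV[K]_n)).
  by apply/funext => y; rewrite fct_sumE [LHS]row_sum_delta.
by apply: differentiable_sum => j; exact: differentiableZl.
Qed.

Section GermCalculus.
Variables (K : numClosedFieldType) (n : nat).
Local Notation V := 'rV[K]_n.
Implicit Types (f g h phi psi : V -> V).

(** Exactly what lets an identity of germs be precomposed with [f]. It is weaker than holomorphy, so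
    that [root_section] qualifies. *)
Definition vanishing f := f x @[x --> (0 : V)] --> (0 : V).

Lemma vanishing_near f (P : set V) : vanishing f -> nbhs (0 : V) P ->
  nbhs (0 : V) (fun x => P (f x)).
Proof. by move=> vf nP; exact: vf. Qed.

Lemma vanishing_comp f g : vanishing f -> vanishing g -> vanishing (g \o f).
Proof. by move=> vf vg; exact: cvg_comp vf vg. Qed.

Lemma holo_vanishing f : holo_germ f -> vanishing f.
Proof.
by move=> [f0 /nbhs_singleton /differentiable_continuous]; rewrite /vanishing -[X in _ --> X]f0.
Qed.

Lemma germ_eq_refl f : germ_eq f f.
Proof. by rewrite /germ_eq; near=> x. Unshelve. all: by end_near. Qed.

Lemma germ_eq_sym f g : germ_eq f g -> germ_eq g f.
Proof. by apply: filterS => x ->. Qed.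

Lemma germ_eq_trans f g h : germ_eq f g -> germ_eq g h -> germ_eq f h.
Proof. by apply: filterS2 => x -> ->. Qed.

Lemma germ_eq_compl f f' g : germ_eq f f' -> germ_eq (g \o f) (g \o f').
Proof. by apply: filterS => x /= ->. Qed.

Lemma germ_eq_compr f g g' : vanishing f -> germ_eq g g' -> germ_eq (g \o f) (g' \o f).
Proof. by move=> vf; exact: vanishing_near. Qed.

Lemma holo_germ_eq f g : germ_eq f g -> holo_germ g -> holo_germ f.
Proof.
move=> fg [g0 dg]; split; first by rewrite (nbhs_singleton fg).
have := nbhs_interior fg; apply: filterS2 dg => x dgx fgx.
exact: near_eq_differentiable fgx dgx.
Qed.

Lemma holo_comp f g : holo_germ f -> holo_germ g -> holo_germ (g \o f).
Proof.
move=> hf [g0 dg]; have [f0 df] := hf; split; first by rewrite /= f0.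
apply: filterS2 df (vanishing_near (holo_vanishing hf) dg) => x dfx dgx.
exact: differentiable_comp.
Qed.

Lemma holo_id : holo_germ (@id V).
Proof. by split => //; near=> x. Unshelve. all: by end_near. Qed.

Lemma inverse_comp h h' g g' : inverse_germs h h' -> inverse_germs g g' ->
  inverse_germs (g \o h) (h' \o g').
Proof.
move=> [hh hh' e1 e2] [gg gg' e3 e4]; split; try exact: holo_comp.
  apply: germ_eq_trans e3 => /=.
  by have := vanishing_near (holo_vanishing gg') e1; apply: filterS => x /= ->.
apply: germ_eq_trans e2 => /=.
by have := vanishing_near (holo_vanishing hh) e4; apply: filterS => x /= ->.
Qed.

Lemma holo_iter phi m : holo_germ phi -> holo_germ (iter m phi).
Proof.
move=> hphi; elim: m => [|m IH]; first exact: holo_id.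
by have := holo_comp IH hphi.
Qed.

Lemma iter_invariant f phi m : holo_germ phi -> germ_eq (f \o phi) f ->
  germ_eq (f \o iter m phi) f.
Proof.
move=> hphi e; elim: m => [|m IH]; first exact: germ_eq_refl.
apply: germ_eq_trans IH.
exact: (germ_eq_compr (holo_vanishing (holo_iter m hphi)) e).
Qed.

End GermCalculus.

Section StandardFold.
Variables (K : numClosedFieldType) (n : nat).
Local Notation V := 'rV[K]_n.+1.
Implicit Types (f g h phi psi : V -> V).

Lemma std_foldE k (x : V) : std_fold k x = upd (x 0 0 ^+ k) x.
Proof.
apply/rowP => j; rewrite updE !mxE (_ : (val j == 0%N) = (j == 0))//.
by case: eqP => [->|].
Qed.

Definition rot (z : K) (x : V) : V := upd (z * x 0 0) x.

Lemma upd_linear_differentiable (a : V -> K) (x : V) : differentiable a x ->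
  differentiable (fun x => upd (a x) x) x.
Proof.
move=> da; apply: differentiableD; first by [].
apply: differentiableZl; apply: differentiableB => //; exact: differentiable_coord.
Qed.

Lemma rot_holo z : holo_germ (rot z).
Proof.
split.
  by rewrite /rot [X in _ * X]mxE mulr0 /upd mxE subrr scale0r addr0.
near=> x; apply: upd_linear_differentiable.
by apply: differentiableM => //; exact: differentiable_coord.
Unshelve. all: by end_near. Qed.

Lemma std_fold_holo k : (0 < k)%N -> holo_germ (std_fold k : V -> V).
Proof.
move=> k0; split.
  by apply/rowP => j; rewrite !mxE expr0n (gtn_eqF k0); case: ifP.
near=> x; have -> : (std_fold k : V -> V) = (fun x : V => upd (x 0 0 ^+ k) x).
  by apply/funext => y; exact: std_foldE.
apply: upd_linear_differentiable.
apply: (@differentiable_comp K V K K (fun x : V => x 0 0) (fun w => w ^+ k)).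
  exact: differentiable_coord.
exact: exprn_differentiable.
Unshelve. all: by end_near. Qed.

Lemma rotM z w x : rot z (rot w x) = rot (z * w) x.
Proof. by rewrite /rot updE eqxx upd_upd mulrA. Qed.

Lemma rot1 x : rot 1 x = x.
Proof. by rewrite /rot mul1r upd_id. Qed.

Lemma std_fold_rot k z x : z ^+ k = 1 -> std_fold k (rot z x) = std_fold k x.
Proof. by move=> zk; rewrite !std_foldE updE eqxx upd_upd exprMn zk mul1r. Qed.

Definition root_section k (y : V) : V := upd (k.-root (y 0 0)) y.

Lemma std_fold_root k y : (0 < k)%N -> std_fold k (root_section k y) = y.
Proof. by move=> k0; rewrite std_foldE updE eqxx rootCK// upd_upd upd_id. Qed.

Lemma root_section_vanishing k : (0 < k)%N -> vanishing (root_section k).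
Proof.
move=> k0; apply: (proj2 (@cvgrPdist_lt K V V (nbhs (0 : V)) _ (root_section k) 0)) => e e0.
have ek : 0 < e ^+ k by rewrite exprn_gt0.
apply: filterS2 (near_dist_lt (0 : V) e0) (near_dist_lt (0 : V) ek) => y.
rewrite !sub0r !normrN => ye yk; apply: upd_lt => //.
have : `|k.-root (y 0 0)| ^+ k < e ^+ k.
  by rewrite -normrX rootCK//; exact: le_lt_trans (rV_coord_norm_le _ _) yk.
by rewrite ltr_pXn2r// nnegrE ltW.
Qed.

End StandardFold.

(** Write w^k - v^k = (w - v) G(w): the cofactor equals k v^(k-1) at v, hence is nonzero nearby. *)
Lemma root_of_unity_isolated (K : numFieldType) (k : nat) (v : K) : (0 < k)%N -> v ^+ k = 1 ->
  \forall w \near v, w ^+ k = 1 -> w = v.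
Proof.
move=> k0 vk.
pose G (w : K) := \sum_(i < k) w ^+ (k.-1 - i) * v ^+ i.
have cG : {for v, continuous G}.
  apply: continuous_sum_ord => i.
  apply: (@continuous_at_mul K K (fun w => w ^+ (k.-1 - i)) (cst (v ^+ i)));
    last exact: cst_continuous.
  exact: (differentiable_continuous (exprn_differentiable _ _)).
have v0 : v != 0 by apply: contra_eq_neq vk => ->; rewrite expr0n (gtn_eqF k0) eq_sym oner_neq0.
have Gv : G v != 0.
  rewrite /G (eq_bigr (fun=> v ^+ k.-1)) => [|i _].
    by rewrite sumr_const card_ord mulrn_eq0 negb_or -lt0n k0 expf_neq0.
  by rewrite -exprD subnK// -ltnS (prednK k0).
have nG : \forall w \near v, G w != 0 by exact: (cvgr_neq0 _ cG Gv).
near=> w => wk; have Gw : G w != 0 by near: w.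
 apply/eqP; rewrite -subr_eq0.
have : (w - v) * G w = 0.
  rewrite /G -[RHS](subrr 1) -{1}wk -vk -[X in _ = w ^+ X - _](prednK k0) -[X in _ = _ - v ^+
    X](prednK k0).
  by rewrite subrXX (prednK k0); congr (_ * _); apply: eq_bigr => i _; rewrite subSS.
by move/eqP; rewrite mulf_eq0 (negPf Gw) orbF.
Unshelve. all: by end_near. Qed.

(** * Rigidity of the symmetries of the standard fold *)

Section Symmetry.
Local Open Scope complex_scope.
Variable R : realType.
Local Notation C := (cplx R).

(** [root_of_unity_isolated] makes [q] locally constant, and the interval is connected. *)
Lemma root_of_unity_path (k : nat) (q : R -> C) (T : R) : (0 < k)%N ->
  (forall t, 0 < t < T -> {for t, continuous q}) ->
  (forall t, 0 < t < T -> q t ^+ k = 1) ->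
  forall s t, 0 < s < T -> 0 < t < T -> q s = q t.
Proof.
move=> k0 cq qk s t sT tT.
have loc u : 0 < u < T -> \forall v \near u, 0 < v < T /\ q v = q u.
  move=> uT; have := cq u uT _ (root_of_unity_isolated k0 (qk u uT)) => /= nq.
  have nT : \forall v \near u, 0 < v < T.
    by case/andP: uT => u0 uT; near=> v; apply/andP; split; near: v;
      [exact: lt_nbhsr|exact: lt_nbhsl].
  near=> v; have vT : 0 < v < T by near: v.
  by split => //; move: (qk v vT); near: v.
(* Local constancy makes any condition on [q u] open; equality with [q t] and its negation then give
   a set that is open and closed in the interval. *)
have oB (P : C -> Prop) : open [set u : R | 0 < u < T /\ P (q u)].
  rewrite openE => u [uT Pu]; rewrite /interior /=.
  by apply: filterS (loc u uT) => v /= [vT qv]; rewrite qv.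
have cI : connected (`]0, T[ : set R) by apply/connected_intervalP; exact: interval_is_interval.
have := cI [set u : R | 0 < u < T /\ q u = q t].
move=> H; have : [set u : R | 0 < u < T /\ q u = q t] = `]0, T[%classic.
  apply: H.
  - by exists t.
  - exists [set u : R | 0 < u < T /\ q u = q t]; first exact: (oB (fun z => z = q t)).
    by apply/seteqP; split=> u /=; rewrite in_itv /= => -[].
  - exists (~` [set u : R | 0 < u < T /\ q u <> q t]).
      by apply: open_closedC; exact: (oB (fun z => z <> q t)).
    apply/seteqP; split=> u /=; rewrite in_itv /=.
      by move=> [-> qu]; split => // -[].
    move=> [uT nu]; split => //; apply: contrapT => qu; exact: nu.
by move/seteqP => [_ /(_ s)] /=; rewrite in_itv /= => /(_ sT)[].
Unshelve. all: by end_near. Qed.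

Variables (m : nat).
Local Notation V := 'rV[C]_m.+1.

Lemma real_scale_continuous (x : V) : continuous (fun t : R => (t%:C : C) *: x).
Proof. by move=> t; apply: cvgZl; exact: real_complex_continuous. Qed.

(* The ratio [p (t *: x) / (t * x 0 0)] is a root of unity and depends continuously on
   the real number [t > 0], so [t |-> p (t *: x)] is linear. *)
Lemma homogeneous_root_linear (k : nat) (p : V -> C) (r : C) : (0 < k)%N ->
  (forall x : V, `|x| < r -> differentiable p x) ->
  (forall x : V, `|x| < r -> p x ^+ k = x 0 0 ^+ k) ->
  forall x : V, `|x| < r -> p x = 'd p (0 : V) x.
Proof.
move=> k0 dp pk x xr.
have r0 : 0 < r := le_lt_trans (normr_ge0 x) xr.
have n0 : `|0 : V| < r by rewrite normr0.
have p0 : p 0 = 0.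
  by apply/eqP; have := pk 0 n0; rewrite mxE expr0n (gtn_eqF k0) => /eqP; rewrite expf_eq0 =>
    /andP[].
(* [T] exceeds 1 so that t = 1, that is [x] itself, lies in the open interval together with small
   t. *)
have [T [T1 TP]] : exists T : R, 1 < T /\ forall t, 0 < t < T -> `|(t%:C : C) *: x| < r.
  pose u := (r - `|x|) / (`|x| + 1).
  have x1 : 0 < `|x| + 1 by apply: ltr_wpDl.
  have u0 : 0 < u by rewrite divr_gt0// subr_gt0.
  have uE : u = (complex.Re u)%:C by rewrite RRe_real// gtr0_real.
  have u0' : 0 < complex.Re u by rewrite -ltcR -uE.
  exists (1 + complex.Re u); split; first by rewrite ltrDl.
  move=> t /andP[t0 tT]; rewrite normrZ normcR gtr0_norm//.
  have tu : (t%:C : C) <= 1 + u by rewrite uE -[1]/(1%:C) -rmorphD lecR ltW.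
  apply: le_lt_trans (ler_wpM2r (normr_ge0 x) tu) _.
  rewrite mulrDl mul1r -ltrBrDl /u mulrAC ltr_pdivrMr// ltr_pM2l ?subr_gt0//.
  by rewrite ltrDl.
have [c cP] : exists c : C, forall t, 0 < t < T -> p ((t%:C : C) *: x) = t%:C * c.
  case: (eqVneq (x 0 0) 0) => [x0|x0].
    exists 0 => t tT; rewrite mulr0; apply/eqP.
    have := pk _ (TP t tT); rewrite mxE x0 mulr0 expr0n (gtn_eqF k0) => /eqP.
    by rewrite expf_eq0 => /andP[].
  pose q (t : R) := p ((t%:C : C) *: x) / (t%:C * x 0 0).
  have tn t : 0 < t < T -> (t%:C : C) * x 0 0 != 0.
    by move=> /andP[t0 _]; rewrite mulf_neq0// gt_eqF// ltcR.
  have H := @root_of_unity_path k q T k0.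
  exists (q 1 * x 0 0) => t tT.
  have -> : q 1 = q t.
    apply: H => //; last by rewrite ltr01 T1.
      move=> u uT; apply: continuous_at_mul.
        apply: (@cvg_comp _ _ _ (fun t : R => (t%:C : C) *: x) p _ (nbhs ((u%:C : C) *: x))).
          exact: real_scale_continuous.
        exact: (differentiable_continuous (dp _ (TP u uT))).
      apply: cvgV; first exact: tn.
      apply: (@continuous_at_mul C R (fun t => t%:C : C) (cst (x 0 0)));
        last exact: cst_continuous.
      exact: real_complex_continuous.
    move=> u uT; rewrite /q expr_div_n (pk _ (TP u uT)) mxE divff// expf_neq0//.
    exact: tn.
  by rewrite /q mulrCA divfK ?tn.
have -> : p x = c by have := cP 1; rewrite ltr01 T1 scale1r mul1r; apply.
have d0 := dp 0 n0.
apply/eqP; rewrite -subr_eq0 -normr_le0; apply/ler_addgt0Pr => e e0; rewrite add0r.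
(* Since p(t x) = t p(x) for these real t, the first-order estimate at 0, taken at t x and divided
   by t, bounds the difference of p(x) and the differential at x by e' |x| <= e. *)
pose e' := e / (`|x| + 1).
have x1 : 0 < `|x| + 1 by rewrite ltr_wpDl.
have e'0 : 0 < e' by rewrite divr_gt0.
have nt : ((t%:C : C) *: x) @[t --> (0 : R)] --> (0 : V).
  have E : ((0 : R)%:C : C) *: x = 0 by exact: scale0r.
  by have := @real_scale_continuous x 0; rewrite /continuous_at E.
have /nt /nbhs_ballP[d /= d00 dP] := diff_approx d0 e'0.
pose t := Num.min d 1 / 2.
have m0 : 0 < Num.min d 1 by rewrite lt_min d00 ltr01.
have t0 : 0 < t by rewrite divr_gt0.
have tm : t < Num.min d 1 by rewrite ltr_pdivrMr// ltr_pMr// ltr1n.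
have tT : 0 < t < T.
  by rewrite t0 (lt_trans _ T1)// (lt_le_trans tm)// ge_min lexx orbT.
have td : ball 0 d t.
  by rewrite /ball /= sub0r normrN gtr0_norm// (lt_le_trans tm)// ge_min lexx.
have tC : (0 : C) < t%:C by rewrite ltcR.
have : `|p ((t%:C : C) *: x) - p 0 - 'd p (0 : V) ((t%:C : C) *: x - 0)| <=
  e' * `|(t%:C : C) *: x - 0| by exact: dP t td.
rewrite p0 !subr0 (cP t tT) linearZ /= -mulrBr normrM normrZ.
rewrite (gtr0_norm tC) mulrCA ler_pM2l// => h; apply: (le_trans h).
by rewrite /e' mulrAC ler_pdivrMr// ler_pM2l// lerDl.
Qed.

End Symmetry.

(** * Symmetries of k-folds *)

Section FoldSymmetries.
Variables (R : realType) (m : nat).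
Local Notation C := (cplx R).
Local Notation V := 'rV[C]_m.+1.
Implicit Types (f g h l phi psi : V -> V).

(** The first coordinate of [phi] is its own differential at 0, whose k-th power is x_0^k. It thus
    vanishes on the hyperplane x_0 = 0 and is a multiple of x_0; [z] is its value on the first basis
    vector. The other coordinates are untouched by the fold, hence fixed by [phi]. *)
Lemma std_fold_symmetry k phi : (0 < k)%N -> holo_germ phi ->
  germ_eq (std_fold k \o phi) (std_fold k) ->
  exists2 z : C, z ^+ k = 1 & germ_eq phi (rot z).
Proof.
move=> k0 [phi0 dphi] e.
have /nbhs_ballP[r /= r0 rP] : nbhs (0 : V) (fun x : V => differentiable phi x /\
    std_fold k (phi x) = std_fold k x) by apply: filterS2 dphi e.
have B (x : V) : `|x| < r -> differentiable phi x /\ std_fold k (phi x) = std_fold k x.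
  by move=> xr; apply: rP; rewrite -ball_normE /= sub0r normrN.
pose p (x : V) := phi x 0 0.
have dp (x : V) : `|x| < r -> differentiable p x.
  move=> /B[dx _].
  exact: (@differentiable_comp C V V C phi (fun y : V =>
    y 0 0) x dx (differentiable_coord _ 0 0)).
have pk (x : V) : `|x| < r -> p x ^+ k = x 0 0 ^+ k.
  by move=> /B[_]; rewrite !std_foldE => /rowP /(_ 0); rewrite !updE eqxx.
have pL := homogeneous_root_linear k0 dp pk.
(* Both sides are homogeneous of degree k, so scaling extends the identity from the ball to all
   vectors. *)
have Lk (x : V) : 'd p (0 : V) x ^+ k = x 0 0 ^+ k.
  have x1 : 0 < `|x| + 1 by apply: ltr_wpDl.
  have [s s0 sr] : exists2 s, 0 < s & `|s *: x| < r.
    exists (r / (`|x| + 1)); first by rewrite divr_gt0.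
    by rewrite normrZ gtr0_norm ?divr_gt0// mulrAC ltr_pdivrMr// ltr_pM2l// ltrDl.
  have sk : s ^+ k != 0 by rewrite expf_neq0// gt_eqF.
  by have := pk _ sr; rewrite pL// linearZ /= !mxE !exprMn => E; exact: (mulfI sk E).
have L0 (x : V) : x 0 0 = 0 -> 'd p (0 : V) x = 0.
  move=> x0; apply/eqP; have := Lk x; rewrite x0 expr0n (gtn_eqF k0) => /eqP.
  by rewrite expf_eq0 => /andP[].
pose e0 : V := delta_mx 0 0.
exists ('d p (0 : V) e0); first by rewrite Lk mxE !eqxx expr1n.
have LE (x : V) : 'd p (0 : V) x = 'd p (0 : V) e0 * x 0 0.
  have h : 'd p (0 : V) (x - x 0 0 *: e0) = 0.
    by apply: L0; rewrite !mxE !eqxx mulr1 subrr.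
  by move/eqP: h; rewrite linearB linearZ /= subr_eq0 mulrC => /eqP.
apply/nbhs_ballP; exists r => // x; rewrite -ball_normE /= sub0r normrN => xr.
apply/rowP => j; rewrite /rot updE; case: eqP => [->|/eqP j0].
  by rewrite -[LHS]/(p x) pL.
have [_] := B x xr; rewrite !std_foldE => /rowP /(_ j).
by rewrite !updE (negPf j0).
Qed.

Definition fold_data k f l l' h h' :=
  [/\ inverse_germs l l', inverse_germs h h' & germ_eq f (l \o std_fold k \o h')].

Lemma rot_invariant k f l l' h h' z : (0 < k)%N -> fold_data k f l l' h h' -> z ^+ k = 1 ->
  germ_eq (f \o (h \o rot z \o h')) f.
Proof.
move=> k0 [_ [hh hh' e1 e2] e] zk.
have v1 := holo_vanishing (holo_comp hh' (holo_comp (rot_holo m z) hh)).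
have v2 := holo_vanishing (holo_comp hh' (rot_holo m z)).
have E1 := vanishing_near v1 e; have E2 := vanishing_near v2 e2.
apply: filterS3 e E1 E2 => x /= ex -> ->.
by rewrite std_fold_rot.
Qed.

(** Conjugating [phi] by [h] and cancelling [l] with [l'] reduces to [std_fold_symmetry]. *)
Lemma fold_symmetry k f l l' h h' phi : (0 < k)%N -> fold_data k f l l' h h' ->
  holo_germ phi -> germ_eq (f \o phi) f ->
  exists2 z : C, z ^+ k = 1 & germ_eq phi (h \o rot z \o h').
Proof.
move=> k0 [[hl hl' l1 l2] [hh hh' e1 e2] e] hphi ephi.
have hs := @std_fold_holo C m k k0.
have hpsi : holo_germ (h' \o phi \o h) by apply: holo_comp => //; exact: holo_comp.
have epsi : germ_eq (std_fold k \o (h' \o phi \o h)) (std_fold k).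
  have vh := holo_vanishing hh.
  have A1 := vanishing_near vh ephi.
  have A2 := vanishing_near (vanishing_comp vh (holo_vanishing hphi)) e.
  have A3 := vanishing_near vh e.
  have A4 : nbhs (0 : V) (fun x => l' (l (std_fold k (h' (phi (h x))))) = std_fold k (h' (phi
    (h x)))).
    exact: (vanishing_near (holo_vanishing (holo_comp hpsi hs)) l2).
  have A5 : nbhs (0 : V) (fun x => l' (l (std_fold k (h' (h x)))) = std_fold k (h' (h x))).
    exact: (vanishing_near (holo_vanishing (holo_comp (holo_comp hh hh') hs)) l2).
  near=> x; rewrite /=.
  have B1 : f (phi (h x)) = f (h x) by near: x.
  have B2 : f (phi (h x)) = l (std_fold k (h' (phi (h x)))) by near: x.
  have B3 : f (h x) = l (std_fold k (h' (h x))) by near: x.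
  have B4 : h' (h x) = x by near: x.
  have <- : l' (l (std_fold k (h' (phi (h x))))) = std_fold k (h' (phi (h x))) by near: x.
  have B5 : l' (l (std_fold k (h' (h x)))) = std_fold k (h' (h x)) by near: x.
  by rewrite -B2 B1 B3 B5 B4.
have [z zk ez] := std_fold_symmetry k0 hpsi epsi; exists z => //.
have A1 := vanishing_near (holo_vanishing hh') ez.
have A2 := vanishing_near (holo_vanishing (holo_comp hh' (holo_comp hh hphi))) e1.
near=> x.
have B1 : h' (phi (h (h' x))) = rot z (h' x) by near: x.
have B2 : h (h' (phi (h (h' x)))) = phi (h (h' x)) by near: x.
have B3 : h (h' x) = x by near: x.
by rewrite /= -B1 B2 B3.
Unshelve. all: by end_near. Qed.

Lemma iter_conj phi h h' z i : inverse_germs h h' -> germ_eq phi (h \o rot z \o h') ->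
  germ_eq (iter i phi) (h \o rot (z ^+ i) \o h').
Proof.
move=> [hh hh' e1 e2] e; elim: i => [|i IH].
  by apply: filterS e1 => x /= xe; rewrite expr0 rot1 xe.
have hc := holo_comp hh' (holo_comp (rot_holo m (z ^+ i)) hh).
have A1 := vanishing_near (holo_vanishing hc) e.
have A2 := vanishing_near (holo_vanishing (holo_comp hh' (rot_holo m (z ^+ i)))) e2.
near=> x.
have B0 : iter i phi x = h (rot (z ^+ i) (h' x)) by near: x.
have B1 : phi (h (rot (z ^+ i) (h' x))) = h (rot z (h' (h (rot (z ^+ i) (h' x))))) by near: x.
have B2 : h' (h (rot (z ^+ i) (h' x))) = rot (z ^+ i) (h' x) by near: x.
by rewrite iterS B0 B1 B2 rotM exprS.
Unshelve. all: by end_near. Qed.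

(** If the order n of [z] were smaller than k, the n-th iterate of [alpha] would be the identity,
    against its order being k. *)
Lemma fold_generator k f l l' h h' alpha : (0 < k)%N -> fold_data k f l l' h h' ->
  holo_germ alpha -> has_order alpha k -> germ_eq (f \o alpha) f ->
  exists2 z : C, k.-primitive_root z & germ_eq alpha (h \o rot z \o h').
Proof.
move=> k0 fd ha [_ _ ord] ea; have [_ hi _] := fd; have [hh hh' e1 e2] := hi.
have [z zk ez] := fold_symmetry k0 fd ha ea.
exists z => //.
have [n nz nk] := prim_order_exists k0 zk.
suff -> : k = n by [].
apply/eqP; rewrite eq_sym eqn_leq (dvdn_leq k0 nk) /= leqNgt; apply/negP => nk'.
have n0 := prim_order_gt0 nz.
apply: (ord n); first by rewrite n0.
have := iter_conj n hi ez; rewrite (prim_expr_order nz).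
by apply: filterS2 e1 => x /= xe E; rewrite E rot1 xe.
Qed.

(** Membership in the cyclic group becomes a condition on [f] alone, so conjugacy of groups can be
    tested on the folds. A symmetry is a rotation by some w, and w is a power of the primitive root
    attached to [alpha]. *)
Lemma cyclic_germsP k f l l' h h' alpha phi : (0 < k)%N -> fold_data k f l l' h h' ->
  holo_germ alpha -> has_order alpha k -> germ_eq (f \o alpha) f ->
  cyclic_germs alpha phi <-> holo_germ phi /\ germ_eq (f \o phi) f.
Proof.
move=> k0 fd ha oa ea; have [_ hi _] := fd.
split=> [[i [e|[hphi hiter e1 e2]]]|[hphi ephi]].
- split; first exact: holo_germ_eq e (holo_iter i ha).
  apply: germ_eq_trans (iter_invariant i ha ea); exact: germ_eq_compl.
- split => //.
  have A1 := vanishing_near (holo_vanishing hphi) (iter_invariant i ha ea).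
  near=> x.
  have B1 : f (iter i alpha (phi x)) = f (phi x) by near: x.
  have B2 : iter i alpha (phi x) = x by near: x.
  by rewrite /= -B1 B2.
- have [w wk ew] := fold_symmetry k0 fd hphi ephi.
  have [z zp ez] := fold_generator k0 fd ha oa ea.
  have [i wE] := prim_rootP zp wk.
  exists i; left; apply: (germ_eq_trans ew); rewrite wE.
  exact: germ_eq_sym (iter_conj i hi ez).
Unshelve. all: by end_near. Qed.

(* [h o root_section k o l'] is a section of [f] which need not be continuous
   near [0], but it tends to [0] at [0]. *)
Lemma fold_epi k f l l' h h' phi psi : (0 < k)%N -> fold_data k f l l' h h' ->
  germ_eq (phi \o f) (psi \o f) -> germ_eq phi psi.
Proof.
move=> k0 [[hl hl' l1 l2] [hh hh' e1 e2] e] ep.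
pose s := h \o root_section k \o l'.
have vr := @root_section_vanishing C m k k0.
have v1 := vanishing_comp (holo_vanishing hl') vr.
have vs : vanishing s := vanishing_comp v1 (holo_vanishing hh).
have A1 := vanishing_near vs ep; have A2 := vanishing_near vs e.
have A3 := vanishing_near v1 e2.
near=> x.
have B1 : phi (f (s x)) = psi (f (s x)) by near: x.
have B2 : f (s x) = l (std_fold k (h' (s x))) by near: x.
have B3 : h' (h (root_section k (l' x))) = root_section k (l' x) by near: x.
have B4 : l (l' x) = x by near: x.
by move: B1; rewrite B2 /s /= B3 std_fold_root// B4.
Unshelve. all: by end_near. Qed.

End FoldSymmetries.

(** * Factorization of invariant germs through a fold *)

Section Factorization.
Variables (R : realType) (m : nat).
Local Notation C := (cplx R).
Local Notation V := 'rV[C]_m.+1.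
Implicit Types (f g h l phi psi : V -> V).

Lemma rot_invariant_ball (z r : C) (k : nat) (F : V -> V) : k.-primitive_root z ->
  (forall x : V, `|x| < r -> F (rot z x) = F x) ->
  forall (i : nat) (x : V), `|x| < r -> F (rot (z ^+ i) x) = F x.
Proof.
move=> zk Fz i x xr; have k0 := prim_order_gt0 zk.
have nz := norm_primitive_root zk.
have r0 : 0 < r := le_lt_trans (normr_ge0 x) xr.
elim: i => [|i IH]; first by rewrite expr0 rot1.
rewrite exprS -rotM Fz// /rot; apply: upd_lt => //.
rewrite normrM normrX nz expr1n mul1r.
exact: le_lt_trans (rV_coord_norm_le _ _) xr.
Qed.

(** The coordinates of [F \o root_section k] are [descended] functions, so [descent] gives
    holomorphy. The factorization survives the choice of branch: the chosen root of x_0^k is z^i x_0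
    for some i, which [F] does not distinguish from x_0. *)
Lemma std_fold_factor (z : C) (k : nat) (F : V -> V) : k.-primitive_root z -> holo_germ F ->
  germ_eq (F \o rot z) F ->
  holo_germ (F \o root_section k) /\ germ_eq (F \o root_section k \o std_fold k) F.
Proof.
move=> zk [F0 dF] Fz; have k0 := prim_order_gt0 zk.
split.
  split.
    have -> : (F \o root_section k) 0 = F (root_section k 0) by [].
    suff -> : root_section k (0 : V) = 0 by [].
    apply/rowP => j; rewrite updE !mxE; case: eqP => // _.
    by apply/eqP; rewrite rootC_eq0.
  have dj (j : 'I_m.+1) : nbhs (0 : V) (fun x : V => differentiable (descended k (fun x =>
    F x 0 j)) x).
    apply: (descent zk).
      apply: filterS dF => x dx.
      exact: (@differentiable_comp C V V C F (fun y : V =>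
        y 0 j) x dx (differentiable_coord _ 0 j)).
    by apply: filterS Fz => x /= E; rewrite -/(rot z x) E.
  have H := @filter_forall V 'I_m.+1 (fun j (x : V) =>
    differentiable (descended k (fun x : V => F x 0 j)) x) (nbhs (0 : V)) (nbhs_filter _) dj.
  by near=> x; apply: rV_differentiable; near: x; exact: H.
have /nbhs_ballP[r /= r0 rP] := Fz.
have B (x : V) : `|x| < r -> F (rot z x) = F x.
  by move=> xr; apply: rP; rewrite -ball_normE /= sub0r normrN.
apply/nbhs_ballP; exists r => // x; rewrite -ball_normE /= sub0r normrN => xr.
have [i iE] : exists i : nat, k.-root (x 0 0 ^+ k) = z ^+ i * x 0 0.
  have ak := rootCK k0 (x 0 0 ^+ k).
  have [x0|x0] := eqVneq (x 0 0) 0.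
    by exists 0%N; rewrite x0 mulr0 expr0n (gtn_eqF k0); apply/eqP; rewrite rootC_eq0.
  have : (k.-root (x 0 0 ^+ k) / x 0 0) ^+ k = 1 by rewrite expr_div_n ak divff// expf_neq0.
  by move=> /(prim_rootP zk)[i iE]; exists i; rewrite -iE divfK.
rewrite /root_section std_foldE updE eqxx upd_upd iE.
exact: (rot_invariant_ball zk B).
Unshelve. all: by end_near. Qed.

Lemma fold_factor k f l l' h h' g z : fold_data k f l l' h h' -> k.-primitive_root z ->
  holo_germ g -> germ_eq (g \o (h \o rot z \o h')) g ->
  exists2 L, holo_germ L & germ_eq g (L \o f).
Proof.
move=> [[hl hl' l1 l2] [hh hh' e1 e2] e] zk hg eg; have k0 := prim_order_gt0 zk.
have hF := holo_comp hh hg.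
have FE : germ_eq ((g \o h) \o rot z) (g \o h).
  have A1 := vanishing_near (holo_vanishing hh) eg.
  near=> x.
  have B1 : g (h (rot z (h' (h x)))) = g (h x) by near: x.
  have B2 : h' (h x) = x by near: x.
  by rewrite /= -{1}B2 B1.
have [hM ME] := std_fold_factor zk hF FE.
exists ((g \o h) \o root_section k \o l'); first exact: holo_comp.
have A1 := vanishing_near (holo_vanishing hh') ME.
have A2 := vanishing_near (holo_vanishing (holo_comp hh' (@std_fold_holo C m k k0))) l2.
near=> x.
have B1 : g (h (root_section k (std_fold k (h' x)))) = g (h (h' x)) by near: x.
have B2 : l' (l (std_fold k (h' x))) = std_fold k (h' x) by near: x.
have B3 : h (h' x) = x by near: x.
have B4 : f x = l (std_fold k (h' x)) by near: x.
by rewrite /= B4 B2 B1 B3.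
Unshelve. all: by end_near. Qed.

Lemma kfold_data k f : kfold k f -> exists l l' h h', fold_data k f l l' h h'.
Proof. by move=> [_ [l [h [h' [[l' hl] hh e]]]]]; exists l, l', h, h'. Qed.

Lemma fold_data_comp k f l l' h h' g g' : fold_data k f l l' h h' -> inverse_germs g g' ->
  fold_data k (f \o g') l l' (g \o h) (h' \o g').
Proof.
move=> [hl hh e] hg; split => //; first exact: inverse_comp.
by have [_ hg' _ _] := hg; exact: (germ_eq_compr (holo_vanishing hg') e).
Qed.

(** Each fold is invariant under a generating symmetry of the other, so g = L f and f = M g. Then M
    L f = f and L M g = g, and [fold_epi] cancels the folds on the right. *)
Lemma folds_equivalent k f l l' h h' g j j' i i' z w : (0 < k)%N ->
  fold_data k f l l' h h' -> fold_data k g j j' i i' -> holo_germ f -> holo_germ g ->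
  k.-primitive_root z -> k.-primitive_root w ->
  germ_eq (g \o (h \o rot z \o h')) g -> germ_eq (f \o (i \o rot w \o i')) f ->
  exists2 L, biholo_germ L & germ_eq g (L \o f).
Proof.
move=> k0 fd gd hf hg zk wk eg ef.
have [L hL LE] := fold_factor fd zk hg eg.
have [M hM ME] := fold_factor gd wk hf ef.
exists L => //; exists M; split => //.
  apply: (fold_epi k0 gd).
  near=> x; have B1 : g x = L (f x) by near: x.
  have B2 : f x = M (g x) by near: x.
  by rewrite /= -B2 -B1.
apply: (fold_epi k0 fd).
near=> x; have B1 : g x = L (f x) by near: x.
have B2 : f x = M (g x) by near: x.
by rewrite /= -B1 -B2.
Unshelve. all: by end_near. Qed.

End Factorization.

(** * The two implications *)

Section Main.
Variables (R : realType) (m s : nat).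
Local Notation C := (cplx R).
Local Notation V := 'rV[C]_m.+1.
Implicit Types (k : 'I_s -> nat) (p g alpha beta : 'I_s -> cmap C m.+1).

(** By [cyclic_germsP] both groups are symmetry groups, and the source change [h] of the equivalence
    carries symmetries of [p i] to symmetries of [g i]. The reverse inclusion pulls [psi] back to
    [h' \o psi \o h] and cancels [l i] by its inverse. *)
Lemma equivalent_conjugate k p g alpha beta :
  (forall i, (2 <= k i)%N) -> divergent_diagram k p -> divergent_diagram k g ->
  (forall i, reflection (k i) (alpha i)) -> (forall i, reflection (k i) (beta i)) ->
  associated alpha p -> associated beta g ->
  equivalent_diagrams p g ->
  conjugate_product_groups (product_group alpha) (product_group beta).
Proof.
move=> hk hp hg ra rb pa gb [l [h [h' [hl hi e]]]]; exists h, h'; split => // i.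
have k0 : (0 < k i)%N := ltnW (hk i).
have [hh hh' e1 e2] := hi.
have [pl [pl' [ph [ph' pd]]]] := kfold_data (hp i).
have [gl [gl' [gh [gh' gd]]]] := kfold_data (hg i).
have [[a' [ha _ _ _]] _ oa _] := ra i; have [[b' [hb _ _ _]] _ ob _] := rb i.
have PA phi := cyclic_germsP phi k0 pd ha oa (pa i).
have PB phi := cyclic_germsP phi k0 gd hb ob (gb i).
have [l' [hli hli' l1 l2]] := hl i; have ei := e i.
have [hpi _] := hp i.
rewrite /product_group; apply/seteqP; split => psi /=.
  move=> [phi /PA[hphi ephi] epsi]; apply/PB.
  have hc := holo_comp hh' (holo_comp hphi hh).
  split; first exact: holo_germ_eq epsi hc.
  have A1 := vanishing_near (holo_vanishing hc) ei.
  have A2 := vanishing_near (holo_vanishing (holo_comp hh' hphi)) e2.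
  have A3 := vanishing_near (holo_vanishing hh') ephi.
  near=> x.
  have B0 : psi x = h (phi (h' x)) by near: x.
  have B1 : g i (h (phi (h' x))) = l i (p i (h' (h (phi (h' x))))) by near: x.
  have B2 : h' (h (phi (h' x))) = phi (h' x) by near: x.
  have B3 : p i (phi (h' x)) = p i (h' x) by near: x.
  have B4 : g i x = l i (p i (h' x)) by near: x.
  by rewrite /= B0 B1 B2 B3 B4.
move=> /PB[hpsi epsi]; exists (h' \o psi \o h).
  apply/PA; have hc := holo_comp hh (holo_comp hpsi hh').
  split => //.
  have A1 := vanishing_near (holo_vanishing (holo_comp hh hpsi)) ei.
  have A2 := vanishing_near (holo_vanishing hh) epsi.
  have A3 := vanishing_near (holo_vanishing hh) ei.
  have A4 := vanishing_near (holo_vanishing (holo_comp hc hpi)) l2.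
  have A5 := vanishing_near (holo_vanishing hpi) l2.
  near=> x.
  have B1 : g i (psi (h x)) = l i (p i (h' (psi (h x)))) by near: x.
  have B2 : g i (psi (h x)) = g i (h x) by near: x.
  have B3 : g i (h x) = l i (p i (h' (h x))) by near: x.
  have B4 : l' (l i (p i (h' (psi (h x))))) = p i (h' (psi (h x))) by near: x.
  have B5 : l' (l i (p i x)) = p i x by near: x.
  have B6 : h' (h x) = x by near: x.
  by rewrite /= -B4 -B1 B2 B3 B6 B5.
have A1 := vanishing_near (holo_vanishing hpsi) e1.
have A2 : nbhs (0 : V) (fun x : V => psi (h (h' x)) = psi x) by apply: filterS e1 => x /= ->.
near=> x.
have B1 : psi (h (h' x)) = psi x by near: x.
have B2 : h (h' (psi x)) = psi x by near: x.
by rewrite /= B1 B2.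
Unshelve. all: by end_near. Qed.

(** The conjugating [h] serves as source change for all indices at once: [p i \o h'] is again a fold
    and has the same symmetries as [g i], so [folds_equivalent] yields the target change for each
    [i] separately. *)
Lemma conjugate_equivalent k p g alpha beta :
  (forall i, (2 <= k i)%N) -> divergent_diagram k p -> divergent_diagram k g ->
  (forall i, reflection (k i) (alpha i)) -> (forall i, reflection (k i) (beta i)) ->
  associated alpha p -> associated beta g ->
  conjugate_product_groups (product_group alpha) (product_group beta) ->
  equivalent_diagrams p g.
Proof.
move=> hk hp hg ra rb pa gb [h [h' [hi cE]]].
have [hh hh' e1 e2] := hi.
have H i : exists L, biholo_germ L /\ germ_eq (g i) (L \o p i \o h').
  have k0 : (0 < k i)%N := ltnW (hk i).
  have [pl [pl' [ph [ph' pd]]]] := kfold_data (hp i).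
  have [gl [gl' [gh [gh' gd]]]] := kfold_data (hg i).
  have [[a' [ha _ _ _]] _ oa _] := ra i; have [[b' [hb _ _ _]] _ ob _] := rb i.
  have PA phi := cyclic_germsP phi k0 pd ha oa (pa i).
  have PB phi := cyclic_germsP phi k0 gd hb ob (gb i).
  have [hpi _] := hp i; have [hgi _] := hg i.
  (* Only the primitive root is kept; the invariances are then checked on the model rotations in the
     coordinates of each fold. *)
  have [z zp _] := fold_generator k0 pd ha oa (pa i).
  have [w wp _] := fold_generator k0 gd hb ob (gb i).
  have fd := fold_data_comp pd hi.
  have [[_ _ _ _] [hph hph' _ _] _] := pd.
  have [[_ _ _ _] [hgh hgh' _ _] _] := gd.
  have [||L bL LE] := folds_equivalent k0 fd gd (holo_comp hh' hpi) hgi zp wp.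
  - suff /PB[] : cyclic_germs (beta i) ((h \o ph) \o rot z \o (ph' \o h')) by [].
    have := cE i; rewrite /product_group => <-.
    exists (ph \o rot z \o ph'); last exact: germ_eq_refl.
    apply/PA; split; first by apply: holo_comp => //; apply: holo_comp => //; exact: rot_holo.
    exact: (rot_invariant k0 pd (prim_expr_order zp)).
  - have : cyclic_germs (beta i) (gh \o rot w \o gh').
      apply/PB; split; first by apply: holo_comp => //; apply: holo_comp => //; exact: rot_holo.
      exact: (rot_invariant k0 gd (prim_expr_order wp)).
    have := cE i; rewrite /product_group => <- [phi /PA[hphi ephi] ew].
    have A1 := vanishing_near (holo_vanishing (holo_comp hh' hphi)) e2.
    have A2 := vanishing_near (holo_vanishing hh') ephi.
    near=> x.
    have B0 : gh (rot w (gh' x)) = h (phi (h' x)) by near: x.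
    have B1 : h' (h (phi (h' x))) = phi (h' x) by near: x.
    have B2 : p i (phi (h' x)) = p i (h' x) by near: x.
    by rewrite /= B0 B1 B2.
  by exists L.
have [l lP] := choice H.
exists l, h, h'; split => // i; first by have [] := lP i.
by have [_] := lP i.
Unshelve. all: by end_near. Qed.

End Main.

Theorem theorem4p4 (R : realType) (n s : nat) (k : 'I_s -> nat)
    (p g alpha beta : 'I_s -> cmap R[i] n)
    (hn : (2 <= n)%N) (hs : (1 <= s <= n)%N)
    (hk : forall i, (2 <= k i)%N)
    (hp : divergent_diagram k p) (hg : divergent_diagram k g)
    (halpha : forall i, reflection (k i) (alpha i))
    (hbeta : forall i, reflection (k i) (beta i))
    (hpalpha : associated alpha p) (hgbeta : associated beta g) :
  equivalent_diagrams p g <->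
  conjugate_product_groups (product_group alpha) (product_group beta).
Proof.
(* The bound on [n] rules out dimension 0; the successor form provides the index of the first
   coordinate. *)
case: n p g alpha beta hn hs hp hg halpha hbeta hpalpha hgbeta => // m p g alpha beta.
move=> _ _ hp hg ra rb pa gb; split.
  exact: (@equivalent_conjugate R m s k p g alpha beta).
exact: (@conjugate_equivalent R m s k p g alpha beta).
Qed.
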